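(* Let $n\geq 2$ and let $f:\mathcal{K}_{\infty}^n\rightarrow \mathbb{C}$ be a smooth function with compact support. Then $$\int_{\mathcal{L}_n}\widetilde{f}\,dm_{\mathcal{L}_n}=q^n\int_{\mathcal{K}_{\infty}^n}f\,d\operatorname{Vol}.$$
   Context: Let $q$ be a prime power, $\mathcal{R}=\mathbb{F}_q[x]$, $\mathcal{K}_\infty=\mathbb{F}_q((x^{-1}))$ with absolute value normalized by $|x|=q$, and $\mathcal{O}_\infty=\mathbb{F}_q[[x^{-1}]]$. $\operatorname{Vol}$ is the Haar measure on $\mathcal{K}_\infty^n$ with $\operatorname{Vol}(\mathcal{O}_\infty^n)=1$; $\Vert\mathbf{v}\Vert=\max_i|v_i|$. A function $f:\mathcal{K}_\infty^n\to\mathbb{C}$ is smooth if there is $\varepsilon>0$ such that $f$ is constant on every ball of radius $\varepsilon$. Let $\mathrm{G}=\mathrm{SL}_n(\mathcal{K}_\infty)$, for which the paper's convention is $\{g\in\mathrm{GL}_n(\mathcal{K}_\infty):|\det g|=1\}$, let $\Gamma=\mathrm{SL}_n(\mathcal{R})$, and let $\mathcal{L}_n=\mathrm{G}/\Gamma$ be the space of unimodular lattices, where $g\Gamma$ corresponds to the lattice $\Lambda=g\mathcal{R}^n$; $m_{\mathcal{L}_n}$ is the $\mathrm{G}$-invariant probability measure on $\mathcal{L}_n$. The Siegel transform of $f$ is $\widetilde{f}(\Lambda)=\sum_{\mathbf{v}\in\Lambda\setminus\{0\}}f(\mathbf{v})$. *)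

(* Defs.v *)
From HB Require Import structures.
From mathcomp Require Import all_boot all_order all_algebra.
From mathcomp Require Import all_classical all_reals all_analysis.
From mathcomp Require Import generic_quotient complex zify.

Set Implicit Arguments.
Unset Strict Implicit.
Unset Printing Implicit Defensive.

Import Order.TTheory GRing.Theory Num.Theory.
Local Open Scope classical_set_scope.
Local Open Scope ring_scope.

(** * The field F((x^-1))

    A Laurent series in x^-1 is given by its coefficients: [a i] is the
    coefficient of x^i, and vanishes for all large i. *)

Record laurent (F : finFieldType) := Laurent {
  lcoef :> int -> F;
  lcoef_bnd : exists N : int, forall i, N < i -> lcoef i = 0 }.

HB.instance Definition _ (F : finFieldType) := gen_eqMixin (laurent F).
HB.instance Definition _ (F : finFieldType) := gen_choiceMixin (laurent F).

Section LaurentField.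
Variable F : finFieldType.
Implicit Types a b c : laurent F.
Local Notation K := (laurent F).

Lemma laurentP a b : (forall i, a i = b i) -> a = b.
Proof.
case: a b => [a ba] [b bb] /= ab; have {}ab : a = b by apply: funext.
by subst b; congr Laurent; exact: Prop_irrelevance.
Qed.

Definition lbnd a (N : int) := forall i, N < i -> a i = 0.

Lemma lbndW a (N M : int) : N <= M -> lbnd a N -> lbnd a M.
Proof. by move=> NM aN i Mi; apply: aN; apply: le_lt_trans Mi. Qed.

Lemma laurent_bndP N a b : lbnd a N -> lbnd b N ->
  (forall j : nat, a (N - j%:Z) = b (N - j%:Z)) -> a = b.
Proof.
move=> aN bN ab; apply: laurentP => i; have [iN|Ni] := leP i N; last first.
  by rewrite aN// bN.
by have := ab `|N - i|%N; have -> : N - `|N - i|%N%:Z = i by lia.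
Qed.

Lemma laurent_shared_bnd a b : exists N, lbnd a N /\ lbnd b N.
Proof.
case: (lcoef_bnd a) (lcoef_bnd b) => N aN [M bM].
by exists (Num.max N M); split; [apply: lbndW aN | apply: lbndW bM]; lia.
Qed.

Fact lzero_bnd : exists N : int, forall i, N < i -> (fun=> 0 : F) i = 0.
Proof. by exists 0. Qed.
Definition lzero : K := Laurent lzero_bnd.

Fact lopp_bnd a : exists N : int, forall i, N < i -> - a i = 0.
Proof. by case: (lcoef_bnd a) => N aN; exists N => i /aN ->; rewrite oppr0. Qed.
Definition lopp a : K := Laurent (lopp_bnd a).

Fact ladd_bnd a b : exists N : int, forall i, N < i -> a i + b i = 0.
Proof.
have [N [aN bN]] := laurent_shared_bnd a b.
by exists N => i Ni; rewrite aN// bN// addr0.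
Qed.
Definition ladd a b : K := Laurent (ladd_bnd a b).

Fact laddA : associative ladd.
Proof. by move=> a b c; apply: laurentP => i; exact: addrA. Qed.
Fact laddC : commutative ladd.
Proof. by move=> a b; apply: laurentP => i; exact: addrC. Qed.
Fact ladd0 : left_id lzero ladd.
Proof. by move=> a; apply: laurentP => i; exact: add0r. Qed.
Fact laddN : left_inverse lzero lopp ladd.
Proof. by move=> a; apply: laurentP => i; exact: addNr. Qed.

HB.instance Definition _ := GRing.isZmodule.Build K laddA laddC ladd0 laddN.

(* The sum over all of int has finite support, so that the default value of
   finitely supported sums is not used. *)
Fact lmul_bnd a b : exists N : int, forall k, N < k ->
  \sum_(i \in [set: int]) a i * b (k - i) = 0.
Proof.
case: (lcoef_bnd a) (lcoef_bnd b) => N aN [M bM].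
exists (N + M) => k NMk; apply: fsbig1 => i _.
have [iN|/aN->] := leP i N; last by rewrite mul0r.
by rewrite bM ?mulr0//; lia.
Qed.
Definition lmul a b : K := Laurent (lmul_bnd a b).

Fact lone_bnd : exists N : int, forall i, N < i -> (i == 0)%:R = 0 :> F.
Proof. by exists 0 => i i0; case: eqP => // i00; lia. Qed.
Definition lone : K := Laurent lone_bnd.

(* The n leading coefficients of a, from that of x^N down, as a polynomial
   in x^-1. *)
Let head (N : int) a n : {poly F} := \poly_(j < n) a (N - j%:Z).

Lemma lmulE N M a b (j : nat) : lbnd a N -> lbnd b M ->
  lmul a b (N + M - j%:Z) =
  \sum_(i < j.+1) a (N - i%:Z) * b (M - (j - i)%N%:Z).
Proof.
move=> aN bM; rewrite /lmul/=.
rewrite (fsbigE [seq N - i%:Z | i <- iota 0 j.+1])//; last 2 first.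
- by rewrite map_inj_uniq ?iota_uniq// => i1 i2; lia.
- move=> i _ /negP iN; have [lei|/aN->] := leP i N; last by rewrite mul0r.
  rewrite bM ?mulr0//; rewrite ltNge; apply/negP => lek; apply: iN.
  by apply/mapP; exists `|N - i|%N; rewrite ?mem_iota; lia.
under eq_bigl do rewrite in_setT.
rewrite big_map -[iota 0 _]/(index_iota 0 j.+1) big_mkord.
by apply: eq_bigr => -[i /= ij] _; congr (_ * b _); lia.
Qed.

Lemma lbnd_mul N M a b : lbnd a N -> lbnd b M -> lbnd (lmul a b) (N + M).
Proof.
move=> aN bM k NMk; apply: fsbig1 => i _.
have [iN|/aN->] := leP i N; last by rewrite mul0r.
by rewrite bM ?mulr0//; lia.
Qed.

Lemma lmul_head N M a b n j : lbnd a N -> lbnd b M -> (j < n)%N ->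
  lmul a b (N + M - j%:Z) = (head N a n * head M b n)`_j.
Proof.
move=> aN bM jn; rewrite (lmulE _ aN bM) coefM; apply: eq_bigr => -[i /= ij] _.
by rewrite !coef_poly !ifT//; lia.
Qed.

Fact lmulC : commutative lmul.
Proof.
move=> a b; case: (lcoef_bnd a) (lcoef_bnd b) => N aN [M bM].
have ba : lbnd (lmul b a) (N + M) by rewrite addrC; exact: lbnd_mul.
apply: (laurent_bndP (lbnd_mul aN bM) ba) => j.
by rewrite (lmul_head aN bM (ltnSn j)) [N + M]addrC (lmul_head bM aN (ltnSn j)) mulrC.
Qed.

Fact lmulA : associative lmul.
Proof.
move=> a b c; case: (lcoef_bnd a) (lcoef_bnd b) (lcoef_bnd c) => N aN [M bM] [L cL].
have ab := lbnd_mul aN bM; have bc := lbnd_mul bM cL.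
have abc : lbnd (lmul (lmul a b) c) (N + (M + L)).
  by rewrite addrA; exact: lbnd_mul.
apply: (laurent_bndP (lbnd_mul aN bc) abc) => j.
rewrite (lmul_head aN bc (ltnSn j)) addrA (lmul_head ab cL (ltnSn j)).
transitivity ((head N a j.+1 * (head M b j.+1 * head L c j.+1))`_j).
  rewrite [LHS]coefM [RHS]coefM; apply: eq_bigr => -[i /= ij] _; congr (_ * _).
  rewrite coef_poly ifT; last by lia.
  by rewrite (lmul_head bM cL (n := j.+1))//; lia.
rewrite mulrA [LHS]coefM [RHS]coefM; apply: eq_bigr => -[i /= ij] _; congr (_ * _).
by rewrite [in RHS]coef_poly ifT// (lmul_head aN bM (n := j.+1)).
Qed.

Fact lmul1 : left_id lone lmul.
Proof.
move=> a; apply: laurentP => k.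
rewrite /lmul/= -(fsbig_widen [set 0]) ?fsbig_set1//= ?eqxx ?mul1r ?subr0//.
by move=> i [_ /= /eqP/negPf ->]; rewrite mul0r.
Qed.

Fact lmulDl : left_distributive lmul +%R.
Proof.
move=> a b c; have [N [aN bN]] := laurent_shared_bnd a b.
case: (lcoef_bnd c) => M cM.
have abN : lbnd (a + b) N by move=> i Ni; rewrite /= aN// bN// addr0.
have sN : lbnd (lmul a c + lmul b c) (N + M).
  move=> i Ni; transitivity (lmul a c i + lmul b c i) => //.
  by rewrite (lbnd_mul aN cM Ni) (lbnd_mul bN cM Ni) addr0.
apply: (laurent_bndP (lbnd_mul abN cM) sN) => j.
transitivity (lmul a c (N + M - j%:Z) + lmul b c (N + M - j%:Z)); last by [].
rewrite !(@lmulE N M)// -big_split/=.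
by apply: eq_bigr => i _; rewrite mulrDl.
Qed.

Fact lone_neq0 : lone != 0.
Proof.
by apply/eqP => /(congr1 (fun a => lcoef a 0)) /= /eqP; rewrite oner_eq0.
Qed.

HB.instance Definition _ := GRing.Zmodule_isComNzRing.Build K
  lmulA lmulC lmul1 lmulDl lone_neq0.

Lemma lcoef0 i : (0 : K) i = 0. Proof. by []. Qed.
Lemma lcoefN a i : (- a) i = - a i. Proof. by []. Qed.
Lemma lcoefD a b i : (a + b) i = a i + b i. Proof. by []. Qed.
Lemma lcoef1 i : (1 : K) i = (i == 0)%:R. Proof. by []. Qed.
Lemma lcoefM a b k : (a * b) k = \sum_(i \in [set: int]) a i * b (k - i).
Proof. by []. Qed.

(** The degree of a nonzero series is the largest exponent occurring in it. *)
Definition is_ldeg a (d : int) := a d != 0 /\ lbnd a d.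
Definition ldeg a : int := xget 0 (is_ldeg a).

Lemma ldeg_uniq a d : is_ldeg a d -> ldeg a = d.
Proof.
move=> ad; apply: xget_unique => // e [ae be]; case: ad => ad bd.
apply/eqP; rewrite eq_le; apply/andP; split; rewrite leNgt; apply/negP => lt.
- by rewrite bd ?eqxx in ae.
- by rewrite be ?eqxx in ad.
Qed.

Lemma ldegP a : a != 0 -> is_ldeg a (ldeg a).
Proof.
move=> a0; suff [d ad] : exists d, is_ldeg a d by rewrite (ldeg_uniq ad).
case: (lcoef_bnd a) => N aN.
have exj : exists j : nat, a (N - j%:Z) != 0.
  apply/not_existsP => aj; move/eqP: a0; apply.
  apply: (laurent_bndP aN) => // j.
  by apply/eqP; rewrite -[_ == _]negbK; apply/negP; exact: aj.
exists (N - (ex_minn exj)%:Z); case: ex_minnP => j aj jmin; split => // i lti.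
have [leN|/aN//] := leP i N.
apply/eqP; rewrite -[_ == _]negbK; apply/negP => ai.
have := jmin `|N - i|%N; have -> : N - `|N - i|%N%:Z = i by lia.
by move=> /(_ ai); lia.
Qed.

(* Coefficients of the inverse of a power series with coefficients p. *)
Let Fixpoint invs (p : nat -> F) n : seq F :=
  if n is m.+1 then
    let s := invs p m in
    rcons s ((p 0%N)^-1 * ((m == 0%N)%:R - \sum_(i < m) s`_i * p (m - i)%N))
  else [::].

Lemma linv_ex a : a != 0 -> exists b, b * a = 1.
Proof.
move=> /ldegP; move: (ldeg a) => d [ad bd].
pose p j := a (d - j%:Z); pose c j := (invs p j.+1)`_j.
have szs n : size (invs p n) = n by elim: n => //= n IH; rewrite size_rcons IH.
have nths n j : (j < n)%N -> (invs p n)`_j = c j.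
  elim: n => // n IH; rewrite ltnS leq_eqVlt => /predU1P[-> //|jn].
  by rewrite /= nth_rcons szs jn IH.
have cE j : \sum_(i < j.+1) c i * p (j - i)%N = (j == 0%N)%:R.
  have p0 : p 0%N != 0 by rewrite /p subr0.
  rewrite big_ord_recr/= subnn {2}/c /= nth_rcons szs ltnn eqxx.
  rewrite mulrC mulVKf//.
  under [X in _ + (_ - X)]eq_bigr => i _ do rewrite nths//.
  by rewrite addrC subrK.
have bP : exists N : int, forall i, N < i ->
    (if i <= - d then c `|- d - i|%N else 0) = 0.
  by exists (- d) => i; rewrite ltNge => /negPf ->.
exists (Laurent bP).
have bN : lbnd (Laurent bP) (- d) by move=> i; rewrite ltNge /= => /negPf ->.
have b1 : lbnd 1 (- d + d) by move=> i i0 /=; case: eqP => // i00; lia.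
apply: (laurent_bndP (lbnd_mul bN bd) b1) => j.
rewrite (lmulE _ bN bd) /= addNr sub0r oppr_eq0 -[_ == _]/(j == 0%N) -cE.
apply: eq_bigr => -[i /= ij] _; congr (_ * _).
by rewrite ifT; [congr (c _)|]; lia.
Qed.

Definition linv a : K :=
  if pselect (exists b, b * a = 1) is left ab then projT1 (cid ab) else 0.

Fact lmulV a : a != 0 -> linv a * a = 1.
Proof. by rewrite /linv => /linv_ex ab; case: pselect => // {}ab; case: cid. Qed.

Fact linv0 : linv 0 = 0.
Proof.
rewrite /linv; case: pselect => // ab; exfalso; case: ab => b /eqP.
by rewrite mulr0 eq_sym oner_eq0.
Qed.

HB.instance Definition _ := GRing.ComNzRing_isField.Build K lmulV linv0.

Local Notation q := (#|F|%:R : rat).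

(** The absolute value takes its values in q^Z and 0, hence in rat. *)
Definition labs a : rat := if a == 0 then 0 else q ^ ldeg a.

Let q_gt1 : 1 < q.
Proof. by rewrite -[1]/(1%:R) ltr_nat card_finNzRing_gt1. Qed.

Let q_gt0 : 0 < q. Proof. exact: lt_trans q_gt1. Qed.

Lemma labs0 : labs 0 = 0. Proof. by rewrite /labs eqxx. Qed.

Lemma labs_ge0 a : 0 <= labs a.
Proof. by rewrite /labs; case: ifP => // _; rewrite exprz_ge0// ltW. Qed.

Lemma labs_eq0 a : labs a = 0 -> a = 0.
Proof.
rewrite /labs; case: eqP => // _ /eqP.
by rewrite expfz_eq0 (gt_eqF q_gt0) andbF.
Qed.

Lemma labs_le a N : labs a <= q ^ N <-> lbnd a N.
Proof.
rewrite /labs; case: eqP => [->|/eqP a0].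
  by split => // _; rewrite exprz_ge0// ltW.
have [ad bd] := ldegP a0; rewrite ler_eXz2l//; split => [dN|aN].
  exact: lbndW bd.
by rewrite leNgt; apply/negP => /aN /eqP; rewrite (negPf ad).
Qed.

Lemma labs1 : labs 1 = 1.
Proof.
rewrite /labs oner_eq0 (@ldeg_uniq _ 0) ?expr0z//; split => [|i i0]; rewrite lcoef1.
  by rewrite eqxx oner_eq0.
by case: eqP i0 => // ->; rewrite ltxx.
Qed.

Lemma labsM a b : labs (a * b) = labs a * labs b.
Proof.
have [->|a0] := eqVneq a 0; first by rewrite mul0r labs0 mul0r.
have [->|b0] := eqVneq b 0; first by rewrite mulr0 labs0 mulr0.
rewrite /labs mulf_eq0 (negPf a0) (negPf b0)/= -expfzDr ?gt_eqF//; congr (_ ^ _).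
have [[ad aN] [bd bM]] := (ldegP a0, ldegP b0).
apply: ldeg_uniq; split; last exact: lbnd_mul.
have := lmulE 0 aN bM; rewrite subr0 big_ord1 /= !subr0 => h.
by apply: contra_neq (mulf_neq0 ad bd) => ab; rewrite -h.
Qed.

Lemma labsN a : labs (- a) = labs a.
Proof.
have h b N : labs b <= q ^ N -> labs (- b) <= q ^ N.
  by move/labs_le => bN; apply/labs_le => i Ni; rewrite /= bN// oppr0.
have hh b : labs (- b) <= labs b.
  have [->|b0] := eqVneq b 0; first by rewrite oppr0.
  by rewrite {2}/labs (negPf b0) h// /labs (negPf b0).
by apply/eqP; rewrite eq_le hh /= -{1}[a]opprK hh.
Qed.

Lemma labsD_max a b : labs (a + b) <= Num.max (labs a) (labs b).
Proof.
have h c d : c != 0 -> labs d <= labs c -> labs (c + d) <= labs c.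
  move=> c0; rewrite [labs c]/labs (negPf c0) => /labs_le dN.
  have /labs_le cN : labs c <= q ^ ldeg c by rewrite /labs (negPf c0).
  by apply/labs_le => i Ni; rewrite /= cN// dN// addr0.
have [->|a0] := eqVneq a 0; first by rewrite add0r le_max lexx orbT.
have [->|b0] := eqVneq b 0; first by rewrite addr0 le_max lexx.
rewrite le_max; have [ba|/ltW ab] := leP (labs b) (labs a).
  by rewrite h.
by rewrite [a + b]addrC (h b a)// orbT.
Qed.

Lemma labsD a b : labs (a + b) <= labs a + labs b.
Proof.
apply: le_trans (labsD_max a b) _.
by rewrite ge_max lerDl lerDr !labs_ge0.
Qed.

Definition ldist a b : rat := labs (a - b).

Fact ldistxx a : ldist a a = 0. Proof. by rewrite /ldist subrr labs0. Qed.
Fact ldist_eq0 a b : ldist a b = 0 -> a = b.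
Proof. by move/labs_eq0/eqP; rewrite subr_eq0 => /eqP. Qed.
Fact ldist_sym a b : ldist a b = ldist b a.
Proof. by rewrite /ldist -labsN opprB. Qed.
Fact ldist_triangle b a c : ldist a c <= ldist a b + ldist b c.
Proof. by rewrite /ldist -[a - c](subrKA b) labsD. Qed.

HB.instance Definition _ :=
  isMetric.Build rat K ldistxx ldist_eq0 ldist_sym ldist_triangle.
HB.instance Definition _ := isPointed.Build K 0.

(** The embedding of F[x] into F((x^-1)). *)
Fact poly_laurent_bnd (p : {poly F}) : exists N : int, forall i, N < i ->
  (if 0 <= i then p`_`|i|%N else 0) = 0.
Proof.
exists (size p)%:Z => i Ni; case: ifP => // _; rewrite nth_default//.
by move: (size p) Ni => n; lia.
Qed.
Definition poly_laurent (p : {poly F}) : K := Laurent (poly_laurent_bnd p).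

Fact poly_laurent_zmod : zmod_morphism poly_laurent.
Proof.
move=> p r; apply: laurentP => i /=.
by case: ifP; rewrite ?coefB// subr0.
Qed.

Fact poly_laurent_monoid : monoid_morphism poly_laurent.
Proof.
split=> [|p r]; apply: laurentP => k.
  by rewrite lcoef1 /= coef1; case: k => [[|k]|k].
have pN (s : {poly F}) : lbnd (poly_laurent s) (size s)%:Z.
  move=> i Ni /=; case: ifP => // _; rewrite nth_default//.
  by move: (size s) Ni => n; lia.
have [k0|k0] := leP 0 k; last first.
  rewrite /= ifF; last by lia.
  apply/esym/fsbig1 => i _; have [i0|i0] := leP 0 i; last by rewrite mul0r.
  by rewrite [X in _ * X]ifF ?mulr0//; lia.
rewrite /= k0 coefM (fsbigE [seq i%:Z | i <- iota 0 `|k|%N.+1])//; last 2 first.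
- by rewrite map_inj_uniq ?iota_uniq// => i1 i2 [].
- move=> i _ /negP ik; case: (leP 0 i) => i0; last by rewrite mul0r.
  rewrite [X in _ * X]ifF ?mulr0//; apply/negP => ki; apply: ik.
  by apply/mapP; exists `|i|%N; rewrite ?mem_iota; lia.
under [RHS]eq_bigl do rewrite in_setT.
rewrite big_map -[iota 0 _]/(index_iota 0 `|k|%N.+1) big_mkord.
apply: eq_bigr => -[i /= ik] _; rewrite ifT; last by lia.
by congr (_ * r`_ _); lia.
Qed.

HB.instance Definition _ :=
  GRing.isZmodMorphism.Build {poly F} K poly_laurent poly_laurent_zmod.
HB.instance Definition _ :=
  GRing.isMonoidMorphism.Build {poly F} K poly_laurent poly_laurent_monoid.

End LaurentField.

(** * The group G = {g in GL_n(K) : |det g| = 1} and the space of lattices *)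

Section Lattices.
Variables (F : finFieldType) (n : nat).
Local Notation K := (laurent F).

Record SLinf := MkSLinf {
  slmx :> 'M[K]_n;
  slmxP : (slmx \in unitmx) && (labs (\det slmx) == 1) }.

HB.instance Definition _ := [isSub for slmx].
HB.instance Definition _ := [Choice of SLinf by <:].

Fact slmul_subproof (g h : SLinf) :
  (g *m h \in unitmx) && (labs (\det (g *m h)) == 1).
Proof.
case: g h => g /andP[gu /eqP g1] [h /andP[hu /eqP h1]] /=.
by rewrite unitmx_mul gu hu det_mulmx labsM g1 h1 mulr1 eqxx.
Qed.
Definition slmul (g h : SLinf) := MkSLinf (slmul_subproof g h).

Fact slone_subproof :
  ((1%:M : 'M[K]_n) \in unitmx) && (labs (\det (1%:M : 'M[K]_n)) == 1).
Proof. by rewrite unitmx1 det1 labs1 eqxx. Qed.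
Definition slone := MkSLinf slone_subproof.

Fact slinv_subproof (g : SLinf) :
  (invmx g \in unitmx) && (labs (\det (invmx g)) == 1).
Proof.
case: g => g /andP[gu /eqP g1] /=; rewrite unitmx_inv gu /=.
have := congr1 (@labs F \o determinant) (mulmxV gu).
by rewrite /= det_mulmx labsM g1 mul1r det1 labs1 => ->.
Qed.
Definition slinv (g : SLinf) := MkSLinf (slinv_subproof g).

Fact slmulA : associative slmul.
Proof. by move=> g h k; apply: val_inj; exact: mulmxA. Qed.
Fact slmul1g : left_id slone slmul.
Proof. by move=> g; apply: val_inj; exact: mul1mx. Qed.
Fact slmulg1 : right_id slone slmul.
Proof. by move=> g; apply: val_inj; exact: mulmx1. Qed.
Fact slmulVg : left_inverse slone slinv slmul.
Proof. by move=> g; apply/val_inj/mulVmx; case/andP: (slmxP g). Qed.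
Fact slmulgV : right_inverse slone slinv slmul.
Proof. by move=> g; apply/val_inj/mulmxV; case/andP: (slmxP g). Qed.

HB.instance Definition _ :=
  isGroup.Build SLinf slmulA slmul1g slmulg1 slmulVg slmulgV.

(* G carries the topology induced by that of the n x n matrices. *)
HB.instance Definition _ := isPointed.Build SLinf slone.
HB.instance Definition _ := PointedTopological.copy SLinf (initial_topology slmx).

(** The arithmetic subgroup SL_n(F[x]). *)
Definition SLpoly : set SLinf :=
  [set g | exists2 s : 'M[{poly F}]_n,
             \det s = 1 & slmx g = map_mx (@poly_laurent F) s].

Lemma SLpoly1 : SLpoly 1%g.
Proof. by exists 1%:M; rewrite ?det1// map_mx1. Qed.

Lemma SLpolyM g h : SLpoly g -> SLpoly h -> SLpoly (g * h)%g.
Proof.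
move=> [s s1 gs] [t t1 ht]; exists (s *m t); rewrite ?det_mulmx ?s1 ?t1 ?mulr1//.
by rewrite map_mxM -gs -ht.
Qed.

Lemma SLpolyV g : SLpoly g -> SLpoly g^-1%g.
Proof.
move=> [s s1 gs]; have su : s \in unitmx by rewrite unitmxE s1 unitr1.
exists (invmx s); first by rewrite det_inv s1 invr1.
have /andP[gu _] := slmxP g; rewrite -[slmx _]/(invmx g).
rewrite -[LHS]mulmx1 -(map_mx1 (@poly_laurent F)) -(mulmxV su) map_mxM -gs.
by rewrite mulmxA mulVmx// mul1mx.
Qed.

(** The quotient G / SL_n(F[x]), with the quotient topology: [g] and [h] are
    identified when g SL_n(F[x]) = h SL_n(F[x]). *)
Definition SLpoly_rel (g h : SLinf) : bool := `[< SLpoly (g^-1 * h)%g >].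

Fact SLpoly_rel_equiv : equiv_class_of SLpoly_rel.
Proof.
split=> [g|g h|h g k].
- by apply/asboolP; rewrite mulVg; exact: SLpoly1.
- by apply/asboolP/asboolP => /SLpolyV; rewrite invgM invgK.
- move=> /asboolP gh /asboolP hk; apply/asboolP.
  by have := SLpolyM gh hk; rewrite -mulgA mulVKg.
Qed.

Canonical SLpoly_equiv := EquivRelPack SLpoly_rel_equiv.

Local Notation Q := (quotient_topology {eq_quot SLpoly_equiv}%qT).
Definition lattice_space : Type := Q.
HB.instance Definition _ := PointedTopological.copy lattice_space Q.
HB.instance Definition _ := Quotient.copy lattice_space Q.

Definition lclass (g : SLinf) : lattice_space := (\pi_lattice_space g)%qT.

Lemma lclassP g h : lclass g = lclass h <-> SLpoly (g^-1 * h)%g.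
Proof.
split=> [/eqmodP/asboolP//|gh].
by apply/eqmodP/asboolP.
Qed.

Lemma lclassK (l : lattice_space) : lclass (repr l) = l.
Proof. exact: reprK. Qed.

(** The lattice g F[x]^n attached to the class of g. *)
Definition lattice (l : lattice_space) : set 'cV[K]_n :=
  [set slmx (repr l) *m map_mx (@poly_laurent F) w | w in [set: 'cV_n]].

Lemma lattice_class g :
  lattice (lclass g) = [set slmx g *m map_mx (@poly_laurent F) w | w in [set: 'cV_n]].
Proof.
have sub h k : lclass h = lclass k ->
    [set slmx k *m map_mx (@poly_laurent F) w | w in [set: 'cV_n]] `<=`
    [set slmx h *m map_mx (@poly_laurent F) w | w in [set: 'cV_n]].
  move=> /lclassP[s _ hk] _ [w _ <-]; exists (s *m w) => //.
  rewrite map_mxM -hk mulmxA; congr (_ *m _).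
  by rewrite -[LHS]/(slmx (h * (h^-1 * k))%g) mulVKg.
by apply/seteqP; split; apply: sub; rewrite lclassK.
Qed.

(** The action of G on the space of lattices by left translation. *)
Definition lact (g : SLinf) (l : lattice_space) : lattice_space :=
  lclass (g * repr l)%g.

Lemma lact_class g h : lact g (lclass h) = lclass (g * h)%g.
Proof.
apply/lclassP; rewrite invgM -mulgA mulKg; apply/lclassP; exact: lclassK.
Qed.

End Lattices.

(** * Borel measures and integrals *)

Notation borel T := (g_sigma_algebraType (@open T)).

Section Integrals.
Variables (R : realType) (F : finFieldType) (n : nat).
Local Notation K := (laurent F).

(** [Vol] is the Haar measure on K^n with Vol(O^n) = 1, where O = F[[x^-1]]. *)
Definition Oinf : set K := [set a | forall i : int, 0 < i -> a i = 0].

Definition normalized_haar (Vol : {measure set (borel 'cV[K]_n) -> \bar R}) :=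
  [/\ forall (v : 'cV[K]_n) (A : set (borel 'cV[K]_n)), measurable A ->
        Vol [set v + w | w in A] = Vol A,
      forall A : set 'cV[K]_n, compact A -> (Vol A < +oo)%E &
      Vol [set v : 'cV[K]_n | forall i, Oinf (v i 0)] = 1%E].

Definition lattice_measure_invariant
    (m : {measure set (borel (lattice_space F n)) -> \bar R}) :=
  forall (g : SLinf F n) (A : set (borel (lattice_space F n))), measurable A ->
    m [set lact g l | l in A] = m A.

(* The balls of 'cV[K]_n are those of the sup norm. *)
Definition smooth (f : 'cV[K]_n -> R[i]) :=
  exists2 e : rat, 0 < e &
    forall u v w : 'cV[K]_n, ball u e v -> ball u e w -> f v = f w.

Definition compact_support (f : 'cV[K]_n -> R[i]) :=
  compact (closure [set v | f v != 0]).

(* For f of compact support the sum has finitely many nonzero terms. *)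
Definition siegel (f : 'cV[K]_n -> R[i]) (l : lattice_space F n) : R[i] :=
  \sum_(v \in lattice l `\ 0) f v.

Definition cintegrable d (T : measurableType d) (mu : {measure set T -> \bar R})
    (f : T -> R[i]) :=
  mu.-integrable setT (fun x => (complex.Re (f x))%:E) /\
  mu.-integrable setT (fun x => (complex.Im (f x))%:E).

Definition cintegral d (T : measurableType d) (mu : {measure set T -> \bar R})
    (f : T -> R[i]) : R[i] :=
  Complex (\int[mu]_x complex.Re (f x)) (\int[mu]_x complex.Im (f x)).

End Integrals.

(* Main.v *)
Require Import Defs.
From mathcomp Require Import all_boot all_order all_algebra.
From mathcomp Require Import all_classical all_reals all_analysis.
From mathcomp Require Import measurable_realfun.
From mathcomp Require Import perm finmap complex zify ring lra.

(** Let mu(A) be the mean number of nonzero lattice vectors in A, for a random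
    lattice with law m.

    - mu is finite on balls.  A finite average over G, in which the unit ball is
      replaced by thin slabs around segments with varying directions, contracts
      the function "number of lattice points in the unit ball" up to an additive
      constant.  Integrating this inequality, after truncation, against the
      invariant probability m bounds the mean.
    - mu is invariant under transvections and dilations, so away from 0 all the
      translates of a small box have the same mass, and mu is proportional to
      volume on boxes that do not contain 0.  It has no atom at 0, because a
      ball of radius q^(-N) contains at most 2^(-N) times as many nonzero
      lattice points as the unit ball has lattice points.
    - The factor is q^n: a unimodular lattice has exactly q^(n(k+1)) points of
      norm at most q^k when k is large, by the LUP decomposition of its basis
      and a comparison of boxes, and dominated convergence applies.

    A smooth function with compact support is a finite linear combination of
    indicators of balls of the same radius. *)

Set Implicit Arguments.
Unset Strict Implicit.
Unset Printing Implicit Defensive.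

Import Order.TTheory GRing.Theory Num.Theory.
Import numFieldNormedType.Exports.
Local Open Scope classical_set_scope.
Local Open Scope ring_scope.

(** * Laurent series *)

(** The obstacle is integrability: m is only known to be an invariant probability, and the number H
    of lattice points in the unit ball is unbounded. If the mean AH of the functions H(h_i .) over
    finitely many h_i in G satisfies AH <= H/2 + b, then invariance gives AH and H the same
    integral, so that this integral, if finite, is at most 2b. Truncation replaces the finiteness.

    The inequality comes from a dichotomy. Let V_k be the space of lattice vectors of norm at most
    q^k. Leading coefficients embed V_(k+1)/V_k into F^n, and the image increases with k, because
    the lattice is stable under multiplication by x. If the image fills F^n early, the count in a
    ball containing all the slabs is known exactly. If not, counts grow by at most q^n/2 at each
    early step, and a nonzero vector lies in fewer slabs the longer it is.

    The factor q^n is the inverse of the covolume: the ball of radius 1/q, of volume q^(-n), is a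
    fundamental domain for F[x]^n. *)

Section LaurentExtra.
Variable F : finFieldType.
Local Notation K := (laurent F).
Implicit Types a b : K.

Lemma lbnd0 k : lbnd (0 : K) k. Proof. by []. Qed.

Lemma lbndN a k : lbnd a k -> lbnd (- a) k.
Proof. by move=> ak i ki; rewrite lcoefN ak// oppr0. Qed.

Lemma lbndD a b k : lbnd a k -> lbnd b k -> lbnd (a + b) k.
Proof. by move=> ak bk i ki; rewrite lcoefD ak// bk// addr0. Qed.

Lemma lbndB a b k : lbnd a k -> lbnd b k -> lbnd (a - b) k.
Proof. by move=> ak bk; exact: (lbndD ak (lbndN bk)). Qed.

Lemma lbndM a b k l : lbnd a k -> lbnd b l -> lbnd (a * b) (k + l).
Proof. by move=> ak bl; exact: (lbnd_mul ak bl). Qed.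

Lemma lbnd_sum I (r : seq I) (P : pred I) (f : I -> K) k :
  (forall i, P i -> lbnd (f i) k) -> lbnd (\sum_(i <- r | P i) f i) k.
Proof.
by move=> fk; apply: (big_ind (fun a => lbnd a k)) => // a b; exact: lbndD.
Qed.

Lemma lbnd_succ a k : lbnd a (k + 1) -> a (k + 1) = 0 -> lbnd a k.
Proof.
move=> ak ak0 i ki; have [->//|ne] := eqVneq i (k + 1).
by apply: ak; move: ne; lia.
Qed.

Lemma lbnd_inv a k : a != 0 -> ~ lbnd a k -> lbnd a^-1 (- (k + 1)).
Proof.
move=> a0 ak; have [ad bd] := ldegP a0.
have dk : k + 1 <= ldeg a.
  rewrite leNgt; apply/negP => dk; apply: ak; apply: lbndW bd.
  by move: dk; lia.
have q0 : (#|F|%:R : rat) != 0.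
  by rewrite pnatr_eq0 -lt0n; apply/card_gt0P; exists 0.
apply/labs_le; have : labs a * labs a^-1 = 1.
  by rewrite -labsM divff// labs1.
rewrite {1}/labs (negPf a0) => h.
have -> : labs a^-1 = #|F|%:R ^ (- ldeg a).
  rewrite -invr_expz; apply: (mulfI (expfz_neq0 (ldeg a) q0)).
  by rewrite h mulfV// expfz_neq0.
rewrite ler_eXz2l; first by move: dk; lia.
by rewrite -[1]/(1%:R) ltr_nat card_finNzRing_gt1.
Qed.

Fact lmono_bnd (e : int) :
  exists N : int, forall i, N < i -> (i == e)%:R = 0 :> F.
Proof. by exists e => i ei; case: eqP => // ie; move: ei; rewrite ie ltxx. Qed.
Definition lmono e : K := Laurent (lmono_bnd e).

Lemma lcoef_monoM e a i : (lmono e * a) i = a (i - e).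
Proof.
rewrite lcoefM -(fsbig_widen [set e]) ?fsbig_set1//= ?eqxx ?mul1r//.
by move=> j [_ /= /eqP/negPf ->]; rewrite mul0r.
Qed.

Lemma lmonoD e e' : lmono (e + e') = lmono e * lmono e'.
Proof. by apply: laurentP => i; rewrite lcoef_monoM/=; congr (_%:R); lia. Qed.

Lemma lmono0 : lmono 0 = 1. Proof. exact: laurentP. Qed.

Lemma lmonoX : lmono 1 = poly_laurent 'X.
Proof. by apply: laurentP => -[[|[|i]]|i] //=; rewrite coefX. Qed.

Lemma lbnd_monoM e a k : lbnd (lmono e * a) k <-> lbnd a (k - e).
Proof.
split=> ak i ki; last by rewrite lcoef_monoM ak//; lia.
by have := ak (i + e); rewrite lcoef_monoM addrK; apply; lia.
Qed.

Lemma lmonoX_exp e k : lmono e ^+ k = lmono (e * k%:Z).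
Proof.
elim: k => [|k IH]; first by rewrite mulr0 lmono0.
by rewrite exprS IH -lmonoD; congr lmono; lia.
Qed.

(* The series with coefficients [c 0, ..., c (d - 1)] at the exponents
   [lo, ..., lo + d - 1]. *)
Fact lser_bnd (lo : int) d (c : 'I_d -> F) : exists N : int, forall i, N < i ->
  \sum_(m < d | lo + m%:Z == i) c m = 0.
Proof.
exists (lo + d%:Z) => i di; apply: big1 => m /eqP mi; move: di.
by rewrite -mi; have := ltn_ord m; lia.
Qed.
Definition lser lo d c : K := Laurent (@lser_bnd lo d c).

Lemma lser_coef lo d (c : 'I_d -> F) (m : 'I_d) : lser lo c (lo + m%:Z) = c m.
Proof.
rewrite /= (big_pred1 m)// => i /=.
by rewrite (inj_eq (addrI _)).
Qed.

Lemma lser1_coef e (a : F) : lser e (fun _ : 'I_1 => a) e = a.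
Proof. by rewrite /= big_ord1_cond addr0 eqxx. Qed.

Lemma lser_out lo d (c : 'I_d -> F) i : (i < lo) || (lo + d%:Z <= i) ->
  lser lo c i = 0.
Proof. by move=> out; apply: big1 => m /eqP; have := ltn_ord m; lia. Qed.

Lemma lbnd_ser lo d (c : 'I_d -> F) : lbnd (lser lo c) (lo + d%:Z - 1).
Proof. by move=> i ib; apply: lser_out; lia. Qed.

Lemma lbnd_poly (p : {poly F}) k :
  lbnd (poly_laurent p) (k%:Z - 1) <-> (size p <= k)%N.
Proof.
split=> [pk|sp i ki].
  apply/leq_sizeP => j kj; have := pk j%:Z => /=; apply.
  by lia.
rewrite /=; case: ifP => // i0; rewrite nth_default//; apply: leq_trans sp _.
by move: ki i0; lia.
Qed.

Lemma lbnd_polyN (p : {poly F}) k : k < 0 -> lbnd (poly_laurent p) k -> p = 0.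
Proof.
move=> k0 pk; apply/eqP; rewrite -size_poly_eq0 -leqn0; apply/lbnd_poly.
by apply: lbndW pk; lia.
Qed.

Lemma poly_frac a : exists p : {poly F}, lbnd (a - poly_laurent p) (-1).
Proof.
have [N aN] := lcoef_bnd a; exists (\poly_(i < `|N|%N.+1) a i%:Z) => i i0.
have {}i0 : 0 <= i by lia.
rewrite lcoefD lcoefN /= i0 coef_poly; case: ifP => [_|/negbT iN].
  by rewrite gez0_abs// subrr.
by rewrite aN ?subr0//; lia.
Qed.

End LaurentExtra.

(** * Boxes *)

Section Boxes.
Variables (F : finFieldType) (n : nat).
Local Notation K := (laurent F).
Implicit Types (u v : 'cV[K]_n).

(** The exponents may differ between coordinates: boxes grow one coordinate at a time ([kbump]), and
    triangular matrices are compared on very elongated ones. *)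
Definition box u (k : 'I_n -> int) : set 'cV[K]_n :=
  [set v | forall i, lbnd (v i 0 - u i 0) (k i)].

Definition cball (k : int) : set 'cV[K]_n := box 0 (fun=> k).

Lemma cballP k v : cball k v <-> forall i, lbnd (v i 0) k.
Proof. by split=> vk i; have := vk i; rewrite mxE subr0. Qed.

Lemma cballW k l : k <= l -> cball k `<=` cball l.
Proof. by move=> kl v /cballP vk; apply/cballP => i; exact: lbndW (vk i). Qed.

Lemma cball_0 k : cball k 0.
Proof. by apply/cballP => i; rewrite mxE. Qed.

Lemma cballB k u v : cball k u -> cball k v -> cball k (u - v).
Proof.
by move=> /cballP uk /cballP vk; apply/cballP => i; rewrite !mxE; exact: lbndB.
Qed.

Lemma cballD k u v : cball k u -> cball k v -> cball k (u + v).
Proof.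
by move=> /cballP uk /cballP vk; apply/cballP => i; rewrite !mxE; exact: lbndD.
Qed.

Lemma box_cball u k v : box u (fun=> k) v <-> cball k (v - u).
Proof. by rewrite cballP; split=> vk i; have := vk i; rewrite !mxE. Qed.

Lemma col_bnd v : exists k, cball k v.
Proof.
suff [k vk] : exists k, forall i, lbnd (v i 0) k by exists k; apply/cballP.
have /choice[f fP] : forall i, exists N, lbnd (v i 0) N.
  by move=> i; have [N] := lcoef_bnd (v i 0); exists N.
exists (\sum_(i < n) `|f i|) => i; apply: lbndW (fP i).
rewrite (bigD1 i)//= (le_trans (ler_norm _))// lerDl sumr_ge0//.
Qed.

Lemma box_bnd u (k : 'I_n -> int) : exists N : nat, box u k `<=` cball N%:Z.
Proof.
have [N uN] := col_bnd u.
exists (absz (`|N| + \sum_i `|k i|)%R) => v vb.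
apply/cballP => i; rewrite -[v i 0](subrK (u i 0) _).
have S0 : 0 <= \sum_i `|k i| by exact: sumr_ge0.
have : `|k i| <= \sum_i `|k i| by rewrite (bigD1 i)//= lerDl sumr_ge0.
move=> ki; apply: lbndD; first by apply: lbndW (vb i); lia.
by move/cballP: uN => /(_ i); apply: lbndW; lia.
Qed.

Lemma box_transl u u' (k : 'I_n -> int) v : box u k u' -> box u k v <-> box u' k v.
Proof.
move=> uu'; split=> h i.
  have -> : v i 0 - u' i 0 = (v i 0 - u i 0) - (u' i 0 - u i 0) by ring.
  exact: (lbndB (h i) (uu' i)).
by rewrite -(subrKA (u' i 0)); exact: (lbndD (h i) (uu' i)).
Qed.

Definition kbump (k : 'I_n -> int) (j : 'I_n) : 'I_n -> int :=
  fun i => k i + (i == j)%:R.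

Definition cshift (j : 'I_n) (e : int) (a : F) : 'cV[K]_n :=
  \col_i (if i == j then lser e (fun _ : 'I_1 => a) else 0).

(** The coefficient of x^(k j + 1) in coordinate j cuts the enlarged box into q translates of the
    original one. *)
Lemma box_refine u (k : 'I_n -> int) j a v :
  box (u + cshift j (k j + 1) a) k v <->
  box u (kbump k j) v /\ (v j 0 - u j 0) (k j + 1) = a.
Proof.
split=> [h|[h ha] i]; last first.
  have := h i; rewrite !mxE /kbump; case: eqP => [->|_]; last by rewrite !addr0.
  move=> vk; rewrite opprD addrA; apply: lbnd_succ.
    apply: lbndB => //; apply: lbndW (lbnd_ser _).
    by rewrite /=; lia.
  by rewrite lcoefD ha lcoefN lser1_coef subrr.
split.
  move=> i; have := h i; rewrite !mxE /kbump; case: eqP => [->|_]; last first.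
    by rewrite !addr0.
  rewrite opprD addrA => /(@lbndW _ _ _ (k j + 1)) vk.
  rewrite -[v j 0 - _](subrK (lser (k j + 1) (fun _ : 'I_1 => a)) _); apply: lbndD.
    by apply: vk; lia.
  by apply: lbndW (lbnd_ser _); lia.
have := h j (k j + 1); rewrite !mxE eqxx opprD addrA => /(_ ltac:(lia))/eqP.
by rewrite (lcoefD (v j 0 - u j 0)) (lcoefN (lser _ _)) lser1_coef subr_eq0 => /eqP.
Qed.

Definition csers lo d (c : 'M[F]_(n, d)) : 'cV[K]_n := \col_i lser lo (c i).

(** The coefficients at the exponents k + 1, ..., k + d cut a ball of radius q^(k + d) into q^(nd)
    balls of radius q^k, indexed by matrices. *)
Lemma box_csers k d (c : 'M[F]_(n, d)) v :
  box (csers (k + 1) c) (fun=> k) v <->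
  cball (k + d%:Z) v /\ c = \matrix_(i, m) v i 0 (k + 1 + m%:Z).
Proof.
split=> [h|[/cballP vd ->] i e ke].
  split.
    apply/cballP => i; have := h i; rewrite mxE => hi.
    rewrite -[v i 0](subrK (lser (k + 1) (c i)) _); apply: lbndD.
      by apply: lbndW hi; lia.
    by apply: lbndW (lbnd_ser _); lia.
  apply/matrixP => i m; have := h i (k + 1 + m%:Z); rewrite !mxE lcoefD lcoefN.
  by rewrite lser_coef => /(_ ltac:(lia))/eqP; rewrite subr_eq0 => /eqP.
rewrite mxE lcoefD lcoefN; have [ed|ed] := leP e (k + d%:Z); last first.
  by rewrite vd// lser_out ?subr0//; lia.
have [m0 em] : exists m0 : nat, e = k + 1 + m0%:Z.
  by exists (absz (e - (k + 1))%R); lia.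
have md : (m0 < d)%N by move: ed; rewrite em; lia.
rewrite em -[m0%:Z]/((Ordinal md : nat)%:Z).
by rewrite lser_coef mxE subrr.
Qed.

End Boxes.

(** * Counting lattice points *)

Section FiniteCard.

(** [fset_set] is empty on infinite sets, which thus get cardinal 0; hence the finiteness hypotheses
    below. *)
Definition ncard (T : choiceType) (A : set T) : nat := #|` fset_set A|.

Lemma ncard_inj (T U : choiceType) (f : T -> U) (A : set T) (B : set U) :
  finite_set B -> injective f -> (forall x, A x -> B (f x)) ->
  (ncard A <= ncard B)%N.
Proof.
move=> fB fi AB.
have fA : finite_set A.
  apply: (sub_finite_set _ (finite_preimage (f := f) _ fB)) => [x /AB//|].
  by move=> x y _ _ /fi.
rewrite /ncard -(card_imfset imfset_key (mem (fset_set A)) fi).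
rewrite -fset_set_image//; apply: fsubset_leq_card.
rewrite -fset_set_sub//; last exact: finite_image.
by move=> _ [x Ax <-]; exact: AB.
Qed.

Lemma ncard_sub (T : choiceType) (A B : set T) :
  finite_set B -> A `<=` B -> (ncard A <= ncard B)%N.
Proof. by move=> fB AB; apply: (@ncard_inj _ _ id). Qed.

Lemma ncard1 (T : choiceType) (x : T) : ncard [set x] = 1%N.
Proof. by rewrite /ncard fset_set1 cardfs1. Qed.

Lemma ncard_sum (T : choiceType) (A : set T) :
  ncard A = (\sum_(x <- fset_set A) 1)%N.
Proof. exact: card_fset_sum1. Qed.

Lemma ncard_gt1P (T : choiceType) (A : set T) x :
  finite_set A -> A x -> (1 < ncard A)%N -> exists2 y, A y & y != x.
Proof.
move=> fA Ax; apply: contraPP => /forall2NP h.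
apply/negP; rewrite -leqNgt -(ncard1 x).
apply: ncard_sub; first exact: finite_set1.
move=> y Ay.
by have [//|/negP] := h y; rewrite negbK => /eqP.
Qed.

Lemma ncard_cond (T : choiceType) (A : set T) (P : pred T) : finite_set A ->
  ncard (A `&` [set x | P x]) = (\sum_(x <- fset_set A | P x) 1)%N.
Proof.
move=> fA; rewrite big_fset_condE -card_fset_sum1; congr #|` _|.
apply/fsetP => x; rewrite in_fset_set; last exact: finite_setIl.
rewrite !inE/= in_fset_set//.
by apply/idP/andP => [/set_mem[/mem_set]//|[/set_mem ? ?]]; apply/mem_set.
Qed.

Lemma ncard_fibers (T : choiceType) (J : finType) (A : set T) (chi : T -> J) :
  finite_set A ->
  ncard A = (\sum_t ncard (A `&` [set x | chi x = t]))%N.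
Proof.
move=> fA; rewrite ncard_sum (partition_big chi xpredT)//=.
apply: eq_bigr => t _; rewrite -ncard_cond//; congr ncard; congr (_ `&` _).
by apply/seteqP; split=> x /= /eqP.
Qed.

Lemma ncard_image (T U : choiceType) (f : T -> U) (A : set T) :
  finite_set A -> injective f -> ncard (f @` A) = ncard A.
Proof.
move=> fA fi; rewrite /ncard fset_set_image//.
exact: (card_imfset imfset_key (mem (fset_set A)) fi).
Qed.

(* First isomorphism theorem, by counting fibres. *)
Lemma ncard_ker (U : zmodType) (T : finZmodType) (X : set U) (chi : U -> T) :
  finite_set X -> (forall x y, X x -> X y -> X (x - y)) ->
  {morph chi : x y / x - y} ->
  ncard X = (#|finset (fun t => `[< exists2 x, X x & chi x = t >])| *
             ncard (X `&` [set x | chi x = 0%R]))%N.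
Proof.
move=> fX XB chiB; rewrite ncard_sum big_seq_cond.
rewrite (partition_big chi
  (mem (finset (fun t => `[< exists2 x, X x & chi x = t >]))))/=; last first.
  move=> x; rewrite andbT in_fset_set// => /set_mem Xx.
  by rewrite inE; apply/asboolP; exists x.
rewrite -sum_nat_const; apply: eq_bigr => t.
rewrite inE => /asboolP[x Xx xt].
under eq_bigl do rewrite andbT; rewrite -big_seq_cond -ncard_cond//.
have fY (P : pred U) : finite_set (X `&` [set x | P x]) by exact: finite_setIl.
have -> : [set x | chi x = 0] = [set x | chi x == 0].
  by apply/seteqP; split=> y /= /eqP.
have X0 : X 0 by rewrite -(subrr x); exact: XB.
have XD y z : X y -> X z -> X (y + z).
  by move=> Xy Xz; rewrite -[z]opprK; apply: (XB) => //; rewrite -sub0r; exact: XB.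
apply/eqP; rewrite eqn_leq; apply/andP; split.
  apply: (@ncard_inj _ _ (fun y => y - x)) => //; first exact: addIr.
  move=> y [Xy /eqP yt]; split; first exact: XB.
  by rewrite /= chiB yt xt subrr.
apply: (@ncard_inj _ _ (fun y => y + x)) => //; first exact: addIr.
move=> y [Xy /eqP y0]; split; first exact: XD.
by move: y0; rewrite -{1}(addrK x y) chiB xt => /eqP; rewrite subr_eq0.
Qed.

End FiniteCard.

Section LatticeCount.
Variables (F : finFieldType) (n : nat).
Local Notation K := (laurent F).
Local Notation G := (SLinf F n).
Local Notation q := #|F|.
Implicit Types (u v : 'cV[K]_n) (g h : G) (k : int).

Definition glattice g : set 'cV[K]_n :=
  [set slmx g *m map_mx (@poly_laurent F) w | w in [set: 'cV_n]].

Lemma latticeE (l : lattice_space F n) : lattice l = glattice (repr l).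
Proof. by []. Qed.

Lemma slmxM g h : slmx (g * h)%g = slmx g *m slmx h. Proof. by []. Qed.

Lemma slmxKV g : slmx g^-1%g *m slmx g = 1%:M.
Proof. by rewrite -slmxM mulVg. Qed.

Lemma slmxK g : slmx g *m slmx g^-1%g = 1%:M.
Proof. by rewrite -slmxM mulgV. Qed.

Lemma slmx_mulKV g v : slmx g^-1%g *m (slmx g *m v) = v.
Proof. by rewrite mulmxA slmxKV mul1mx. Qed.

Lemma slmx_mulK g v : slmx g *m (slmx g^-1%g *m v) = v.
Proof. by rewrite mulmxA slmxK mul1mx. Qed.

Lemma slmx_inj g : injective (fun v : 'cV[K]_n => slmx g *m v).
Proof. exact: can_inj (slmx_mulKV g). Qed.

Lemma glatticeM g h :
  glattice (g * h)%g = [set slmx g *m v | v in glattice h].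
Proof.
apply/seteqP; split=> [_ [w _ <-]|_ [_ [w _ <-] <-]].
  by exists (slmx h *m map_mx (@poly_laurent F) w); rewrite ?mulmxA//; exists w.
by exists w; rewrite ?mulmxA.
Qed.

Lemma lattice_act g (l : lattice_space F n) :
  lattice (lact g l) = [set slmx g *m v | v in lattice l].
Proof. by rewrite lattice_class latticeE -glatticeM. Qed.

Lemma glattice0 g : glattice g 0.
Proof. by exists 0; rewrite // map_mx0 mulmx0. Qed.

Lemma glatticeB g u v : glattice g u -> glattice g v -> glattice g (u - v).
Proof.
by move=> [w _ <-] [w' _ <-]; exists (w - w'); rewrite // map_mxB mulmxBr.
Qed.

Lemma glatticeX g v : glattice g v -> glattice g (lmono F 1 *: v).
Proof.
move=> [w _ <-]; exists ('X *: w) => //.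
by rewrite map_mxZ lmonoX -scalemxAr.
Qed.

Lemma mulmx_bnd m p (A : 'M[K]_(m, p)) : exists N : int, 0 <= N /\
  forall r k (B : 'M[K]_(p, r)), (forall i j, lbnd (B i j) k) ->
    forall i j, lbnd ((A *m B) i j) (N + k).
Proof.
have /choice[f fP] : forall ij : 'I_m * 'I_p, exists N, lbnd (A ij.1 ij.2) N.
  by move=> ij; exact: lcoef_bnd.
exists (\sum_ij `|f ij|); split=> [|r k B Bk i j]; first exact: sumr_ge0.
rewrite mxE; apply: lbnd_sum => s _; apply: lbndM => //.
apply: lbndW (fP (i, s)).
by rewrite (bigD1 (i, s))//= (le_trans (ler_norm _))// lerDl sumr_ge0.
Qed.

Lemma slmx_bnd g : exists N : int, 0 <= N /\
  forall k v, cball k v -> cball (N + k) (slmx g *m v).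
Proof.
have [N [N0 h]] := mulmx_bnd (slmx g); exists N; split=> // k v /cballP vk.
by apply/cballP => i; apply: h => i' j; rewrite ord1.
Qed.

(** As g^(-1) is bounded, the vectors in question have coordinates of bounded degree in the basis g,
    and F is finite. *)
Lemma glattice_finite g k : finite_set (glattice g `&` cball k).
Proof.
have [N [N0 gN]] := slmx_bnd g^-1%g.
pose M := absz (N + k + 1)%R.
apply: (@sub_finite_set _ _ [set slmx g *m map_mx (@poly_laurent F)
  (\col_i rVpoly (row i c)) | c in [set: 'M[F]_(n, M)]]); last first.
  exact/finite_image/finite_finset.
move=> _ [[w _ <-] /gN]; rewrite slmx_mulKV => /cballP wb.
exists (\matrix_(i, j) (w i 0)`_j) => //; congr (_ *m map_mx _ _).
apply/matrixP => i j; rewrite ord1 mxE.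
have -> : row i (\matrix_(i, j) (w i 0)`_j) = poly_rV (w i 0) :> 'rV_M.
  by apply/rowP => m; rewrite !mxE.
apply: poly_rV_K; apply/lbnd_poly; have := wb i; rewrite mxE.
by apply: lbndW; rewrite /M; lia.
Qed.

Lemma glattice_finite_box g u (k : 'I_n -> int) :
  finite_set (glattice g `&` box u k).
Proof.
have [N kN] := box_bnd u k; apply: sub_finite_set (glattice_finite g N%:Z).
exact: setIS.
Qed.

(** The lattice vector is g times the polynomial part of g^(-1) v. *)
Lemma glattice_cocompact g :
  exists k0, forall v, exists2 w, glattice g w & cball k0 (v - w).
Proof.
have [N [N0 gN]] := slmx_bnd g; exists (N - 1) => v.
have /choice[f fP] : forall i, exists p : {poly F},
    lbnd ((slmx g^-1%g *m v) i 0 - poly_laurent p) (-1).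
  by move=> i; exact: poly_frac.
exists (slmx g *m map_mx (@poly_laurent F) (\col_i f i)); first by eexists.
rewrite -{1}(slmx_mulK g v) -mulmxBr; apply: gN.
by apply/cballP => i; have := fP i; rewrite !mxE.
Qed.

Definition lcount g (A : set 'cV[K]_n) : nat := ncard (glattice g `&` A).

(* With V_k the space of lattice vectors of norm at most q^k, this is the
   image of the embedding of V_(k + 1) / V_k into F^n. *)
Definition leads g k : {set 'cV[F]_n} :=
  finset (fun t => `[< exists2 v, (glattice g `&` cball (k + 1)) v &
                                  \col_i (v i 0) (k + 1) = t >]).

(** [ncard_ker] for the coefficients of x^(k + 1), whose kernel on V_(k + 1) is V_k. *)
Lemma lcount_leads g k :
  lcount g (cball (k + 1)) = (#|leads g k| * lcount g (cball k))%N.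
Proof.
rewrite /lcount (@ncard_ker _ _ _ (fun v => \col_i (v i 0) (k + 1))).
- congr (_ * ncard _)%N; apply/seteqP; split=> v.
    move=> [[gv /cballP vk] /= v0]; split=> //; apply/cballP => i.
    apply: lbnd_succ => //.
    by move/matrixP: v0 => /(_ i 0); rewrite !mxE.
  move=> [gv vk]; split; first by split=> //; apply: cballW vk; lia.
  apply/matrixP => i j; rewrite !mxE; move/cballP: vk; apply.
  by lia.
- exact: glattice_finite.
- move=> u v [gu uk] [gv vk].
  by split; [exact: glatticeB | exact: cballB].
- by move=> u v; apply/matrixP => i j; rewrite !mxE.
Qed.

(** Multiplication by x shifts the exponents and keeps the leading coefficients. All control of the
    growth of counts rests on this monotonicity. *)
Lemma leads_mono g k : leads g k \subset leads g (k + 1).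
Proof.
apply/fintype.subsetP => t; rewrite !inE => /asboolP[v [gv /cballP vk] vt].
apply/asboolP; exists (lmono F 1 *: v).
  split; first exact: glatticeX.
  apply/cballP => i; rewrite mxE; apply/lbnd_monoM; apply: lbndW (vk i).
  by lia.
rewrite -vt; apply/matrixP => i j; rewrite !mxE lcoef_monoM; congr (_ _).
by lia.
Qed.

Lemma leads_monoW g k l : k <= l -> leads g k \subset leads g l.
Proof.
move=> kl; have -> : l = k + `|l - k|%N%:Z by lia.
elim: `|l - k|%N => [|m IH]; first by rewrite addr0.
have -> : k + m.+1%:Z = k + m%:Z + 1 by lia.
exact: (fintype.subset_trans IH (leads_mono g _)).
Qed.

(** The coefficient of x^(k j + 1) in coordinate j takes every value a: a lattice vector within q^k0
    of the vector a x^(k j + 1) e_j realizes it. *)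
Lemma lcount_kbump g k0 :
  (forall v, exists2 w, glattice g w & cball k0 (v - w)) ->
  forall (k : 'I_n -> int) j, (forall i, k0 <= k i) ->
  lcount g (box 0 (kbump k j)) = (q * lcount g (box 0 k))%N.
Proof.
move=> gk0 k j kk.
rewrite /lcount (@ncard_ker _ _ _ (fun v => (v j 0) (k j + 1))).
- congr (_ * _)%N.
    rewrite -[RHS]cardsT; apply: eq_card => a; rewrite !inE; apply/asboolP.
    have [w gw vw] := gk0 (cshift j (k j + 1) a); exists w.
      split=> // i; have := vw; rewrite cballP => /(_ i).
      rewrite !mxE subr0 /kbump; case: eqP => [->|_].
        move=> h; rewrite -[w j 0](subKr (lser (k j + 1) (fun _ : 'I_1 => a))).
        apply: lbndB; first by apply: lbndW (lbnd_ser _); lia.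
        by apply: lbndW h; have := kk j; lia.
      by rewrite sub0r => /lbndN; rewrite opprK; apply: lbndW; rewrite addr0.
    move/cballP: vw => /(_ j (k j + 1)).
    rewrite !mxE eqxx lcoefD lcoefN lser1_coef.
    by move=> /(_ ltac:(have := kk j; lia))/eqP; rewrite subr_eq0 => /eqP.
  congr ncard; apply/seteqP; split=> v.
    move=> [[gv vk] /= v0]; split=> // i; have := vk i.
    rewrite mxE subr0 /kbump; case: eqP => [->|_]; last by rewrite addr0.
    by move=> vb; exact: lbnd_succ.
  move=> [gv vk]; split; last first.
    by rewrite /=; have := vk j; rewrite mxE subr0; apply; lia.
  split=> // i; apply: lbndW (vk i); rewrite /kbump; case: eqP => _; lia.
- exact: glattice_finite_box.
- move=> u v [gu uk] [gv vk].
  split; first exact: glatticeB.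
  by move=> i; have := lbndB (uk i) (vk i); rewrite !mxE !subr0.
- by move=> u v; rewrite !mxE.
Qed.

End LatticeCount.

(** * The covolume of unimodular lattices *)

Section Covolume.
Variables (F : finFieldType) (n : nat).
Local Notation K := (laurent F).
Local Notation G := (SLinf F n).
Local Notation q := (#|F|).
Local Notation qQ := (#|F|%:R : rat).
Implicit Types (g h : G) (c : rat).

Lemma card_gt1 : (1 < q)%N. Proof. exact: card_finNzRing_gt1. Qed.

Lemma qQ_gt0 : 0 < qQ. Proof. by rewrite ltr0n ltnW// card_gt1. Qed.

Lemma qQ_neq0 : qQ != 0. Proof. by rewrite gt_eqF// qQ_gt0. Qed.

(** A box of exponents k has volume q^(sum k), so c is the inverse of the covolume. Counts in large
    boxes match it exactly, with no error term. *)
Definition density g c := exists k0 : int, forall k : 'I_n -> int,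
  (forall i, k0 <= k i) -> (lcount g (box 0 k))%:R = c * qQ ^ (\sum_i k i).

Lemma kbump_sum (k : 'I_n -> int) j : \sum_i kbump k j i = \sum_i k i + 1.
Proof.
rewrite /kbump big_split/=; congr (_ + _).
rewrite (bigD1 j)//= eqxx big1 ?addr0// => i /negPf ij.
by rewrite ij.
Qed.

(** Induction on the number sum (k' i - k i) of unit steps. *)
Lemma kbump_ind (P : ('I_n -> int) -> Prop) (k : 'I_n -> int) :
  P k ->
  (forall k' j, (forall i, k i <= k' i) -> P k' -> P (kbump k' j)) ->
  forall k', (forall i, k i <= k' i) -> P k'.
Proof.
move=> Pk Pstep k' kk'.
have [m] : exists m : nat, (\sum_i (k' i - k i) = m%:Z)%R.
  have : 0 <= \sum_i (k' i - k i) by apply: sumr_ge0 => i _; rewrite subr_ge0.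
  by case: (\sum_i _) => // m _; exists m.
elim: m k' kk' => [|m IH] k' kk' km.
  suff -> : k' = k by [].
  apply: funext => i; apply/eqP; rewrite -subr_eq0; apply/eqP.
  have : k' i - k i <= 0.
    rewrite -[X in _ <= X]km (bigD1 i)//= lerDl sumr_ge0// => j _.
    by rewrite subr_ge0.
  by have := kk' i; lia.
have [j jk] : exists j, k j < k' j.
  apply/not_existsP => h; suff : \sum_i (k' i - k i) = 0 by rewrite km.
  apply: big1 => i _; apply/eqP; rewrite subr_eq0 eq_le kk' andbT leNgt.
  exact/negP.
pose k'' := fun i => k' i - (i == j)%:R.
have -> : k' = kbump k'' j by apply: funext => i; rewrite /kbump /k'' subrK.
have kk'' i : k i <= k'' i.
  rewrite /k''; case: eqP => [->|_]; last by rewrite subr0.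
  by move: jk => /=; lia.
apply: Pstep => //; apply: IH => //.
have e : k' = kbump k'' j by apply: funext => i; rewrite /kbump /k'' subrK.
have s1 : \sum_i k' i = \sum_i k'' i + 1 by rewrite {1}e kbump_sum.
clearbody k''; move: km; rewrite !sumrB s1 => km; apply: (@addIr _ 1).
by rewrite addrAC km -addn1 PoszD.
Qed.

Lemma density_of g k0 c :
  (forall (k : 'I_n -> int) j, (forall i, k0 <= k i) ->
     lcount g (box 0 (kbump k j)) = (q * lcount g (box 0 k))%N) ->
  (lcount g (cball k0))%:R = c * qQ ^ (k0 *+ n) -> density g c.
Proof.
move=> step c0; exists k0 => k' kk'.
apply: (@kbump_ind (fun k => (lcount g (box 0 k))%:R = c * qQ ^ (\sum_i k i))
  (fun=> k0)) => //.
  by rewrite sumr_const card_ord.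
move=> k j kk IH; rewrite step// natrM IH kbump_sum mulrCA; congr (_ * _).
by rewrite expfzDr ?qQ_neq0// expr1z mulrC.
Qed.

Lemma density_ex g : exists c, density g c.
Proof.
have [k0 /lcount_kbump step] := glattice_cocompact g.
exists ((lcount g (cball k0))%:R * qQ ^ (- (k0 *+ n))); apply: (density_of step).
by rewrite -mulrA -expfzDr ?qQ_neq0// addNr expr0z mulr1.
Qed.

(** F[x]^n meets the ball of exponent -1, of volume q^(-n), in 0 only, and the translates of this
    ball by F[x]^n cover the space. *)
Lemma density1 : density 1%g (qQ ^+ n).
Proof.
have cocpt (v : 'cV[K]_n) : exists2 w, glattice 1%g w & cball (-1) (v - w).
  have /choice[f fP] : forall i, exists p, lbnd (v i 0 - poly_laurent p) (-1).
    by move=> i; exact: poly_frac.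
  exists (map_mx (@poly_laurent F) (\col_i f i)).
    by exists (\col_i f i); rewrite ?mul1mx.
  by apply/cballP => i; have := fP i; rewrite !mxE.
apply: (@density_of _ (-1)); first exact: lcount_kbump.
rewrite /lcount (_ : _ `&` _ = [set 0]) ?ncard1.
  have -> : (-1) *+ n = - n%:Z :> int by rewrite mulNrn natz.
  by rewrite -invr_expz -exprnP mulfV// expf_neq0// qQ_neq0.
apply/seteqP; split=> [_ [[w _ <-]]|_ ->]; last first.
  by split; [exact: glattice0|exact: cball_0].
rewrite mul1mx => /cballP wb; apply/matrixP => i j; rewrite ord1 mxE mxE.
have -> : w i 0 = 0; last by rewrite raddf0.
by apply: (@lbnd_polyN _ _ (-1)) => //; have := wb i; rewrite mxE.
Qed.

(** The matrix h maps the box of exponents k into the box of exponents k + a, of the same volume, so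
    the lattice of g has at most as many points in the first as that of h g in the second. *)
Lemma density_le g h c c' (a : 'I_n -> int) :
  \sum_i a i = 0 ->
  (forall k0, exists k : 'I_n -> int, (forall i, k0 <= k i) /\
     (forall i j, lbnd (slmx h i j) (k i + a i - k j))) ->
  density g c -> density (h * g)%g c' -> c <= c'.
Proof.
move=> a0 hk [k1 gk1] [k2 gk2].
(* The last summand keeps k + a above the threshold k2 as well. *)
have [k [kk hkb]] := hk (`|k1| + `|k2| + \sum_i `|a i|).
have al i : `|a i| <= \sum_i `|a i| by rewrite (bigD1 i)//= lerDl sumr_ge0.
have := gk1 k; have := gk2 (fun i => k i + a i).
rewrite big_split/= a0 addr0 => e2 e1.
have qk : 0 < qQ ^ (\sum_i k i) by rewrite exprz_gt0// qQ_gt0.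
rewrite -(ler_pM2r qk) -e1 -?e2; first last.
- by move=> i; have := al i; have := kk i; lia.
- by move=> i; have := al i; have := kk i; lia.
rewrite ler_nat; apply: (ncard_inj _ (@slmx_inj _ _ h)).
  exact: glattice_finite_box.
move=> v [gv vk]; split; first by rewrite glatticeM; exists v.
move=> i; rewrite !mxE subr0; apply: lbnd_sum => j _.
have := vk j; rewrite mxE subr0 => /(lbndM (hkb i j)).
by rewrite subrK.
Qed.

(** One inequality is enough: it is stable under products, and its use for g and for g^(-1) gives
    equality. *)
Definition expanding h := forall g c c',
  density g c -> density (h * g)%g c' -> c <= c'.

Lemma expandingM h h' : expanding h -> expanding h' -> expanding (h * h')%g.
Proof.
move=> eh eh' g c c' gc hc'; have [c1 hc1] := density_ex (h' * g)%g.
apply: le_trans (eh' _ _ _ gc hc1) (eh _ _ _ hc1 _).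
by rewrite mulgA.
Qed.

Lemma expanding_bnd0 h : (forall i j, lbnd (slmx h i j) 0) -> expanding h.
Proof.
move=> h0 g c c'; apply: (@density_le _ _ _ _ (fun=> 0)); first exact: big1.
move=> k0; exists (fun=> k0); split=> // i j.
by rewrite addr0 subrr.
Qed.

(* A triangular matrix maps a box whose side lengths grow fast enough in the
   order rho into a box of the same volume. *)
Lemma expanding_trig h (rho : 'I_n -> nat) :
  \prod_i labs (slmx h i i) = 1 ->
  (forall i j, i != j -> slmx h i j != 0 -> (rho j < rho i)%N) -> expanding h.
Proof.
move=> h1 hrho g c c'.
have hii i : slmx h i i != 0.
  apply/eqP => h0; have /eqP := h1; rewrite (bigD1 i)//= h0 labs0 mul0r.
  by rewrite eq_sym oner_eq0.
pose a i := ldeg (slmx h i i).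
have a0 : \sum_i a i = 0.
  have : qQ ^ (\sum_i a i) = qQ ^ (0 : int).
    transitivity (\prod_i qQ ^ a i).
      apply: (big_morph (fun x : int => qQ ^ x)) => // x y.
      by rewrite expfzDr// qQ_neq0.
    rewrite expr0z -[RHS]h1; apply: eq_bigr => i _.
    by rewrite /labs (negPf (hii i)).
  apply: ieexprIz; first exact: qQ_gt0.
  by rewrite gt_eqF// -[1]/(1%:R) ltr_nat card_gt1.
apply: (density_le a0) => k0.
have /choice[f fP] : forall ij : 'I_n * 'I_n, exists N, lbnd (slmx h ij.1 ij.2) N.
  by move=> ij; exact: lcoef_bnd.
(* M dominates the degree of any entry minus any a i, so that a unit of difference in rho absorbs an
   off-diagonal entry. *)
pose M : int := \sum_ij `|f ij| + \sum_i `|a i|.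
have M0 : 0 <= M by rewrite addr_ge0// sumr_ge0.
exists (fun i => `|k0| + M * (rho i)%:Z); split=> [i|i j].
  by have := mulr_ge0 M0 (ler0n int (rho i)); rewrite natz; lia.
have [<-|ij] := eqVneq i j.
  by rewrite addrAC subrr add0r; have [] := ldegP (hii i).
have [->|hij] := eqVneq (slmx h i j) 0; first exact: lbnd0.
apply: lbndW (fP (i, j)).
have fM : f (i, j) <= \sum_ij `|f ij|.
  by rewrite (bigD1 (i, j))//= (le_trans (ler_norm _))// lerDl sumr_ge0.
have aM : - a i <= \sum_i `|a i|.
  by rewrite (bigD1 i)//= (le_trans (ler_norm _))// normrN lerDl sumr_ge0.
have MM : M <= M * ((rho i)%:Z - (rho j)%:Z).
  by rewrite ler_peMr//; have := hrho _ _ ij hij; lia.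
by move: MM fM aM; rewrite mulrBr /M; lia.
Qed.

End Covolume.

Section UnimodularDensity.
Variables (F : finFieldType) (n : nat).
Local Notation K := (laurent F).
Local Notation q := (#|F|).
Local Notation qQ := (#|F|%:R : rat).

Fact mkSL_subproof (A : 'M[K]_n) : labs (\det A) = 1 ->
  (A \in unitmx) && (labs (\det A) == 1).
Proof.
move=> A1; rewrite A1 eqxx andbT unitmxE unitfE; apply/eqP => A0.
by move/eqP: A1; rewrite A0 labs0 eq_sym oner_eq0.
Qed.
Definition mkSL (A : 'M[K]_n) (A1 : labs (\det A) = 1) : SLinf F n :=
  MkSLinf (mkSL_subproof A1).

Lemma labs_prod I (r : seq I) (f : I -> K) :
  labs (\prod_(i <- r) f i) = \prod_(i <- r) labs (f i).
Proof. by apply: big_morph; [exact: labsM | exact: labs1]. Qed.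

End UnimodularDensity.

(** Write P g = L U. The entries of the permutation matrix P^(-1) have degree at most 0. The
    triangular factors L and U fall under [expanding_trig], for the natural order of the coordinates
    and for the reversed one. *)
Lemma expandingT (F : finFieldType) n (g : SLinf F n.+1) : expanding g.
Proof.
have /andP[_ /eqP g1] := slmxP g.
have := cormen_lup_correct (slmx g); have := cormen_lup_perm (slmx g).
have := cormen_lup_detL (slmx g); have := @cormen_lup_upper _ _ (slmx g).
have := @cormen_lup_lower _ _ (slmx g).
case: (cormen_lup (slmx g)) => [[P L] U] /= Llo Uup L1 /is_perm_mxP[s Ps] PLU.
have labs_sign (b : nat) : labs ((-1) ^+ b : laurent F) = 1.
  by elim: b => [|b IH]; rewrite ?expr0 ?labs1// exprS mulN1r labsN.
have U1 : labs (\det U) = 1.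
  have := congr1 (fun A => labs (\det A)) PLU.
  by rewrite !det_mulmx !labsM L1 labs1 mul1r Ps det_perm labs_sign mul1r g1.
have {}L1 : labs (\det L) = 1 by rewrite L1 labs1.
have P1 : labs (\det (perm_mx s^-1 : 'M[laurent F]_n.+1)) = 1.
  by rewrite det_perm labs_sign.
have -> : g = (mkSL P1 * (mkSL L1 * mkSL U1))%g.
  apply: val_inj; rewrite /= -[X in _ *m X]PLU Ps mulmxA -perm_mxM mulVg.
  by rewrite perm_mx1 mul1mx.
apply: expandingM; last apply: expandingM.
- apply: expanding_bnd0 => i j /=; rewrite !mxE.
  by case: eqP => _; [move=> e e0; rewrite lcoef1 gt_eqF | exact: lbnd0].
- apply: (@expanding_trig _ _ _ (@nat_of_ord _)) => /=.
    by rewrite big1// => i _; rewrite Llo// eqxx labs1.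
  move=> i j ij; apply: contraNT; rewrite -leqNgt => /Llo ->.
  by rewrite (negPf ij).
- apply: (@expanding_trig _ _ _ (fun i : 'I_n.+1 => n - i)%N) => /=.
    rewrite -labs_prod -[RHS]U1 -det_tr det_trig.
      by congr labs; apply: eq_bigr => i _; rewrite mxE.
    by apply/is_trig_mxP => i j ij; rewrite mxE Uup.
  move=> i j ij; apply: contraNT; rewrite -leqNgt => h.
  by rewrite Uup//; move: ij (ltn_ord i) (ltn_ord j); rewrite -val_eqE/=; lia.
Qed.

(* This is Riemann-Roch for the vector bundle of rank n and degree 0 on the
   projective line which corresponds to the lattice. *)
Lemma lcount_large (F : finFieldType) n (g : SLinf F n) : (0 < n)%N ->
  exists k0 : nat, forall k : nat, (k0 <= k)%N ->
    lcount g (cball k%:Z) = (#|F| ^ (n * k.+1))%N.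
Proof.
case: n g => // n g _; have [c gc] := density_ex g.
have d1 : density (1%g : SLinf F n.+1) (#|F|%:R ^+ n.+1) by exact: density1.
have ce : c = #|F|%:R ^+ n.+1.
  apply/eqP; rewrite eq_le; apply/andP; split.
    by apply: (expandingT (g := g^-1%g) gc); rewrite mulVg.
  by apply: (expandingT (g := g) d1); rewrite mulg1.
have [k0 gk0] := gc; exists `|k0|%N => k kk.
have := gk0 (fun=> k%:Z) _; rewrite ce sumr_const card_ord => h.
have {}h := h ltac:(move=> _; lia).
apply/eqP; rewrite -(eqr_nat rat); rewrite h natrX; apply/eqP.
rewrite mulnS exprD; congr (_ * _).
by rewrite [RHS]exprnP; congr (_ ^ _); rewrite -mulr_natl natz PoszM.
Qed.

(** * Contraction in the cusp *)

Section Growth.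
Variables (F : finFieldType) (n : nat).
Local Notation K := (laurent F).
Local Notation G := (SLinf F n).
Local Notation q := (#|F|).
Implicit Types (g h : G) (k : int).

Lemma leq_expW a b e : (a <= b -> a ^ e <= b ^ e)%N.
Proof. by case: e => // e ab; rewrite leq_exp2r. Qed.

(** The first multiple x^m v to leave V_k lies in V_(k + 1) and has nonzero leading coefficients, so
    [leads g k] has at least two elements. *)
Lemma lcount_succ_ge2 g k v : glattice g v -> cball k v -> v != 0 ->
  (2 * lcount g (cball k) <= lcount g (cball (k + 1)))%N.
Proof.
move=> gv vk v0; rewrite lcount_leads leq_mul2r; apply/orP; right.
have [i vi] : exists i, v i 0 != 0.
  apply/not_existsP => h; move/eqP: v0; apply; apply/matrixP => i j.
  by rewrite ord1 mxE; apply/eqP; rewrite -[_ == _]negbK; apply/negP; exact: h.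
pose xv m := lmono F 1 ^+ m *: v.
have gx m : glattice g (xv m).
  elim: m => [|m IH]; first by rewrite /xv expr0 scale1r.
  by rewrite /xv exprS -scalerA; exact: glatticeX.
have exm : exists m, `[< ~ cball k (xv m) >].
  have [d vd] := ldegP vi; exists (absz (k - ldeg (v i 0) + 1)%R).
  apply/asboolP => /cballP/(_ i); rewrite mxE lmonoX_exp.
  move/lbnd_monoM => h; move/eqP: d; apply; apply: h.
  by lia.
have [m /asboolP mk mmin] := ex_minnP exm.
have m0 : (0 < m)%N.
  by case: m mk {mmin} => // h; exfalso; apply: h; rewrite /xv expr0 scale1r.
have xk : cball (k + 1) (xv m).
  have h : cball k (xv m.-1).
    by apply: contrapT => h; have := mmin m.-1 (asboolT h); lia.
  apply/cballP => i'; rewrite mxE -(prednK m0) exprS -mulrA.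
  by apply/lbnd_monoM; move/cballP: h => /(_ i'); rewrite mxE addrK.
set t0 : 'cV[F]_n := \col_i' (xv m i' 0) (k + 1).
have t00 : 0 != t0.
  apply/eqP => /matrixP h; apply: mk; apply/cballP => i'.
  apply: lbnd_succ; first by move/cballP: xk; apply.
  by have := h i' 0; rewrite !mxE => <-.
apply: (@leq_trans #|finset.setU [set 0]%SET [set t0]%SET|); first by rewrite cards2 t00.
apply: subset_leq_card; apply/fintype.subsetP => t.
rewrite !inE => /orP[/eqP->|/eqP->]; apply/asboolP.
  exists 0; first by split; [exact: glattice0|exact: cball_0].
  by apply/matrixP => i' j; rewrite !mxE.
by exists (xv m).
Qed.

Lemma leadsB g k s t : s \in leads g k -> t \in leads g k -> s - t \in leads g k.
Proof.
rewrite !inE => /asboolP[u [gu uk] <-] /asboolP[v [gv vk] <-]; apply/asboolP.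
exists (u - v); first by split; [exact: glatticeB | exact: cballB].
by apply/matrixP => i j; rewrite !mxE.
Qed.

(** A proper subgroup of F^n has index at least 2: it is disjoint from its translate by t. *)
Lemma leads_half g k : leads g k != [set: 'cV_n]%SET ->
  (2 * #|leads g k| <= q ^ n)%N.
Proof.
rewrite -finset.subTset => /subsetPn[t _ tl].
have -> : (q ^ n)%N = #|[set: 'cV[F]_n]%SET| by rewrite cardsT card_mx muln1.
rewrite mul2n -addnn -{2}(card_imset (mem (leads g k)) (addrI t)).
have <- : #|leads g k :|: [set t + x | x in leads g k]%SET| =
    (#|leads g k| + #|[set (t + x)%R | x in leads g k]%SET|)%N.
  rewrite cardsU [X in (_ - X)%N](_ : _ = 0)%N ?subn0//.
  apply/eqP; rewrite cards_eq0; apply/eqP/setP => s.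
  apply/negP; rewrite !inE => /andP[sl /imsetP[u ul st]]; move/negP: tl; apply.
  have -> : t = s - u by rewrite st addrK.
  by apply: leadsB => //; rewrite inE.
by apply: subset_leq_card; apply/fintype.subsetP => s; rewrite inE.
Qed.

(** By monotonicity [leads] is also proper at all earlier exponents, so each step multiplies the
    count by at most q^n / 2. *)
Lemma lcount_slow g (J s : nat) : leads g (J%:Z - 1) != [set: 'cV_n]%SET ->
  (s <= J)%N -> (2 ^ s * lcount g (cball s%:Z) <= q ^ (n * s) * lcount g (cball 0))%N.
Proof.
move=> Jl; elim: s => [|s IH] sJ; first by rewrite muln0.
have sl : leads g s%:Z != [set: 'cV_n]%SET.
  apply: contra_neq Jl => sl; apply/eqP; rewrite -finset.subTset -sl.
  by apply: leads_monoW; lia.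
rewrite (_ : s.+1%:Z = s%:Z + 1); last by lia.
rewrite lcount_leads expnS mulnS expnD.
have := leq_mul (leads_half sl) (IH (ltnW sJ)).
by congr (_ <= _)%N; ring.
Qed.

Lemma lcount_fast g (i : nat) k v : glattice g v -> cball k v -> v != 0 ->
  (2 ^ i * lcount g (cball k) <= lcount g (cball (k + i%:Z)))%N.
Proof.
move=> gv vk v0; elim: i => [|i IH]; first by rewrite addr0 mul1n.
rewrite expnS -mulnA (leq_trans (leq_mul (leqnn 2) IH))//.
rewrite (_ : k + i.+1%:Z = k + i%:Z + 1); last by lia.
by apply: (@lcount_succ_ge2 _ _ v) => //; apply: cballW vk; lia.
Qed.

(* While i <= j, each increment of i at least doubles a count larger than 1;
   for i > j it multiplies the count by at most q^n / 2. *)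
Lemma lcount_slab g (j i : nat) : (1 < n)%N ->
  leads g ((n.-1 * j)%N%:Z - 1) != [set: 'cV_n]%SET -> (i <= n * j)%N ->
  ((lcount g (cball (i%:Z - j%:Z))).-1 * 2 ^ j <=
    q ^ (n.-1 * i) * lcount g (cball 0))%N.
Proof.
move=> n1 Jl iM; have q1 := card_gt1 F.
have [ij|ji] := leqP i j.
  (* If the ball contains 0 only, the predecessor makes the left side vanish. *)
  have [|N1] := leqP (lcount g (cball (i%:Z - j%:Z))) 1.
    by case: lcount => [|[]].
  have X0 : (glattice g `&` cball (i%:Z - j%:Z)) 0.
    by split; [exact: glattice0|exact: cball_0].
  have [v [gv vk] v0] := ncard_gt1P (glattice_finite g _) X0 N1.
  have := lcount_fast (j - i) gv vk v0.
  rewrite (_ : i%:Z - j%:Z + (j - i)%N%:Z = 0); last by lia.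
  move=> h; rewrite (leq_trans (leq_mul (leq_pred _) (leqnn _)))//.
  rewrite -{2}(subnKC ij) expnD mulnCA leq_mul//.
    rewrite (@leq_trans (q ^ i))%N ?leq_expW//.
    by rewrite leq_exp2l// leq_pmull//; lia.
  by rewrite mulnC.
have [s si] : exists s : nat, i = (j + s)%N by exists (i - j)%N; lia.
have sJ : (s <= n.-1 * j)%N by move: iM; rewrite si -{1}(prednK (ltnW n1)) mulSn; lia.
have -> : i%:Z - j%:Z = s%:Z by lia.
have h := lcount_slow Jl sJ.
rewrite (leq_trans (leq_mul (leq_pred _) (leqnn _)))//.
have p2 : (0 < 2 ^ s)%N by rewrite expn_gt0.
rewrite -(leq_pmul2l p2) mulnA (leq_trans (leq_mul h (leqnn _)))//.
rewrite -mulnA [X in (_ * X)%N]mulnC mulnA [X in (_ <= X)%N]mulnA leq_mul//.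
have -> : (n * s = n.-1 * s + s)%N by rewrite -{1}(prednK (ltnW n1)) mulSn addnC.
(* What remains is q^s 2^j <= 2^s q^((n-1)j), true because s <= (n-1)j and 2 <= q. *)
rewrite si mulnDr !expnD.
set A := (q ^ (n.-1 * s))%N.
rewrite -mulnA [X in (_ <= X)%N]mulnA [X in (_ <= X)%N]mulnC leq_mul//.
rewrite (@leq_trans (q ^ s * 2 ^ (n.-1 * j)))%N//.
  by rewrite leq_mul// leq_exp2l// leq_pmull//; lia.
rewrite -(subnKC sJ) !expnD mulnCA leq_mul// leq_mul//.
exact: leq_expW.
Qed.

End Growth.

(** * Averages over slabs *)

Section CuspAverage.
Variables (F : finFieldType) (n' : nat).
Local Notation n := (1 + n')%N.
Local Notation K := (laurent F).
Local Notation G := (SLinf F n).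
Local Notation q := (#|F|).
Variable j : nat.
Local Notation J := (n' * j)%N.
Local Notation M := (n * j)%N.
Implicit Types (c d : 'M[F]_(n', M)) (v : 'cV[K]_n) (k : int).

(** These series represent F[[x^(-1)]] modulo x^(-M). The precision fits the shape of a slab, since
    q^M is the ratio of its length q^((n-1)j) to its width q^(-j). The length compensates n - 1
    widths, which gives [slab_mx] determinant 1. *)
Definition slab_coef c (a : 'I_n') : K := lser (1 - M%:Z) (c a).

(* The inverse image of the unit ball under [slab_mx c] is the set of v with
   |v_0| <= q^((n-1)j) and |v_a - c_a v_0| <= q^(-j), a thin neighbourhood of a
   segment of the line spanned by (1, c). *)
Definition slab_mx c : 'M[K]_n :=
  block_mx (lmono F (- J%:Z))%:M 0
           (- (lmono F j%:Z *: \col_a slab_coef c a)) (lmono F j%:Z)%:M.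

Lemma slab_det c : labs (\det (slab_mx c)) = 1.
Proof.
rewrite det_lblock det_scalar1 det_scalar lmonoX_exp -lmonoD.
by rewrite (_ : _ + _ = 0) ?lmono0 ?labs1//; lia.
Qed.

Definition slab c : G := mkSL (slab_det c).

Lemma slab_ball c v : cball 0 (slab_mx c *m v) <->
  lbnd (v (lshift n' 0) 0) J%:Z /\
  forall a, lbnd (v (rshift 1 a) 0 - slab_coef c a * v (lshift n' 0) 0) (- j%:Z).
Proof.
have E : slab_mx c *m v = col_mx (lmono F (- J%:Z) *: usubmx v)
    (lmono F j%:Z *: \col_a (v (rshift 1 a) 0 - slab_coef c a * v (lshift n' 0) 0)).
  rewrite -{1}(vsubmxK v) mul_block_col mul0mx addr0 !mul_scalar_mx; congr col_mx.
  apply/matrixP => a b; rewrite ord1 !mxE big_ord1 !mxE mulrBr addrC mulNr mulrA.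
  by [].
rewrite cballP E; split=> [h|[h1 h2] i].
  split=> [|a].
    have := h (lshift n' 0); rewrite col_mxEu !mxE => /lbnd_monoM.
    by rewrite sub0r opprK.
  by have := h (rshift 1 a); rewrite col_mxEd !mxE => /lbnd_monoM; rewrite sub0r.
case: (split_ordP i) => a ->; rewrite ?col_mxEu ?col_mxEd !mxE; apply/lbnd_monoM.
  by rewrite sub0r opprK ord1.
by rewrite sub0r.
Qed.

Lemma lbnd_slab_coef c a : lbnd (slab_coef c a) 0.
Proof. by apply: lbndW (lbnd_ser _); lia. Qed.

Lemma slab_ball_sub c v : cball 0 (slab_mx c *m v) -> cball J%:Z v.
Proof.
move=> /slab_ball[v0 va]; apply/cballP => i; case: (split_ordP i) => a ->.
  by rewrite ord1.
rewrite -[v _ _](subrK (slab_coef c a * v (lshift n' 0) 0) _); apply: lbndD.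
  by apply: lbndW (va a); lia.
by rewrite -[J%:Z]add0r; apply: lbndM => //; exact: lbnd_slab_coef.
Qed.

Definition slabs v : {set 'M[F]_(n', M)} :=
  finset (fun c => `[< cball 0 (slab_mx c *m v) >]).

(** If v has norm q^(i - j) and lies in the slab of c, then c_a is within q^(-i) of v_a / v_0. This
    fixes the i top coefficients of each c_a and leaves M - i free. Vectors of norm at most q^(-j)
    get i = 0 and the trivial bound. *)
Lemma card_slabs v : v != 0 -> cball J%:Z v ->
  exists i : 'I_M.+1, cball (i%:Z - j%:Z) v /\
                      (#|slabs v| <= q ^ (n' * (M - i)))%N.
Proof.
move=> v0 vJ; have MJ : M%:Z - j%:Z = J%:Z by lia.
have exi : exists i : nat, `[< cball (i%:Z - j%:Z) v >].
  by exists M; apply/asboolP; rewrite MJ.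
have [i /asboolP vi imin] := ex_minnP exi.
have iM : (i < M.+1)%N by rewrite ltnS; apply: imin; apply/asboolP; rewrite MJ.
exists (Ordinal iM); split=> //=.
have [i0|i0] := posnP i.
  rewrite i0 subn0; apply: leq_trans (max_card _) _.
  by rewrite card_mx.
have vi1 : ~ cball (i%:Z - j%:Z - 1) v.
  move=> h; have := imin i.-1; rewrite (_ : i.-1%:Z - j%:Z = i%:Z - j%:Z - 1); last by lia.
  by move=> /(_ (asboolT h)); lia.
pose f c : 'M[F]_(n', (M - i)) := \matrix_(a, m) c a (widen_ord (leq_subr i M) m).
rewrite -card_mx -(@card_in_imset _ _ f); first exact: max_card.
move=> c d; rewrite !inE => /asboolP/slab_ball[_ ca] /asboolP/slab_ball[_ da] cd.
set x := v (lshift n' 0) 0 in ca da.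
(* The coordinate v_0 has the full norm of v: otherwise, as |c_a| <= 1, all the v_a would be smaller
   too. *)
have x1 : ~ lbnd x (i%:Z - j%:Z - 1).
  move=> xl; apply: vi1; apply/cballP => i'; case: (split_ordP i') => a ->.
    by rewrite ord1.
  rewrite -[v _ _](subrK (slab_coef c a * x) _); apply: lbndD.
    by apply: lbndW (ca a); lia.
  rewrite -[i%:Z - j%:Z - 1]add0r; apply: lbndM => //; exact: lbnd_slab_coef.
have x0 : x != 0 by apply: contra_notN x1 => /eqP ->.
apply/matrixP => a m; have [mi|mi] := ltnP m (M - i).
  by have /matrixP/(_ a (Ordinal mi)) := cd; rewrite !mxE; congr (_ = _);
     congr (_ a _); apply: val_inj.
have : lbnd (slab_coef c a - slab_coef d a) (- i%:Z).
  have -> : slab_coef c a - slab_coef d a = ((v (rshift 1 a) 0 - slab_coef d a * x)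
     - (v (rshift 1 a) 0 - slab_coef c a * x)) * x^-1.
    by field.
  have := lbndM (lbndB (da a) (ca a)) (lbnd_inv x0 x1); apply: lbndW.
  by lia.
move=> /(_ (1 - M%:Z + m%:Z)); rewrite lcoefD lcoefN !lser_coef.
by move=> /(_ ltac:(have := ltn_ord m; lia))/eqP; rewrite subr_eq0 => /eqP.
Qed.

(** The ball of exponent J contains every slab; it provides one finite set of vectors for all c. *)
Lemma lcount_slab_mx c (g : G) : lcount (slab c * g)%g (cball 0) =
  ncard ((glattice g `&` cball J%:Z) `&` [set v | `[< cball 0 (slab_mx c *m v) >]]).
Proof.
apply/eqP; rewrite eqn_leq; apply/andP; split.
  apply: (ncard_inj _ (@slmx_inj _ _ (slab c)^-1%g)).
    exact/finite_setIl/glattice_finite.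
  move=> v []; rewrite glatticeM => -[w gw <-] wb; rewrite slmx_mulKV.
  by split; [split=> //; exact: slab_ball_sub wb | apply/asboolP].
apply: (ncard_inj _ (@slmx_inj _ _ (slab c))).
  exact: glattice_finite.
move=> v [[gv vJ] /asboolP vb]; split=> //.
by rewrite glatticeM; exists v.
Qed.

(** Double counting of the pairs (c, v) with v in the slab of c. *)
Lemma sum_lcount_slab (g : G) :
  (\sum_c lcount (slab c * g)%g (cball 0) =
   \sum_(v <- fset_set (glattice g `&` cball J%:Z)) #|slabs v|)%N.
Proof.
transitivity (\sum_c \sum_(v <- fset_set (glattice g `&` cball J%:Z))
    (if `[< cball 0 (slab_mx c *m v) >] then 1 else 0))%N.
  apply: eq_bigr => c _; rewrite lcount_slab_mx ncard_cond ?big_mkcond//.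
  exact: glattice_finite.
rewrite exchange_big/=; apply: eq_bigr => v _.
rewrite -big_mkcond/= sum1_card; apply: eq_card => c.
by rewrite !inE.
Qed.

(** The zero vector lies in all q^(n'M) slabs. A nonzero v is charged to every i whose ball contains
    it, among them the i of [card_slabs]; the predecessor discards 0. *)
Lemma sum_slabs_le (g : G) :
  (\sum_(v <- fset_set (glattice g `&` cball J%:Z)) #|slabs v| <=
   q ^ (n' * M) + \sum_(i < M.+1)
     (lcount g (cball (i%:Z - j%:Z))).-1 * q ^ (n' * (M - i)))%N.
Proof.
have gf := glattice_finite g J%:Z.
set X := glattice g `&` _ in gf *.
have X0 : 0 \in fset_set X.
  rewrite in_fset_set//; apply/mem_set.
  by split; [exact: glattice0|exact: cball_0].
rewrite (big_fsetD1 0)//= leq_add//.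
  by rewrite (leq_trans (max_card _))// card_mx.
pose e (i : 'I_M.+1) v := (v \in fset_set (glattice g `&` cball (i%:Z - j%:Z)) `\ 0)%fset.
have le1 v : v \in (fset_set X `\ 0)%fset ->
    (#|slabs v| <= \sum_(i < M.+1) e i v * q ^ (n' * (M - i)))%N.
  rewrite !inE in_fset_set// => /andP[v0 /set_mem[gv vJ]].
  have [i [vi ci]] := card_slabs v0 vJ.
  rewrite (bigD1 i)//= (_ : e i v = true) ?mul1n ?(leq_trans ci)// ?leq_addr//.
  rewrite /e !inE v0/= in_fset_set; last exact: glattice_finite.
  by apply/mem_set.
apply: (@leq_trans (\sum_(v <- (fset_set X `\ 0%R)%fset)
    \sum_(i < M.+1) e i v * q ^ (n' * (M - i)))%N).
  by rewrite big_seq [leqRHS]big_seq; apply: leq_sum => v; exact: le1.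
rewrite exchange_big/=; apply: leq_sum => i _.
rewrite -big_distrl/= leq_mul2r; apply/orP; right.
rewrite (eq_bigr (fun v => if e i v then 1 else 0)%N)//.
rewrite -big_mkcond/= big_fset_condE -card_fset_sum1.
have Y0 : 0 \in fset_set (glattice g `&` cball (i%:Z - j%:Z)).
  rewrite in_fset_set; last exact: glattice_finite.
  by apply/mem_set; split; [exact: glattice0|exact: cball_0].
rewrite /lcount /ncard (cardfsD1 0 (fset_set _)) Y0/=.
apply: fsubset_leq_card; apply/fsubsetP => v; rewrite !inE.
by rewrite /e !inE => /andP[].
Qed.

(** By [lcount_slab] each of the M + 1 terms of [sum_slabs_le] is at most q^(n'M) 2^(-j) times the
    count in the unit ball. The condition on j bounds the resulting factor (M + 1) 2^(-j) by 1/2. *)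
Lemma cusp_average_slow (g : G) : (0 < n')%N -> leads g (J%:Z - 1) != [set: 'cV_n]%SET ->
  (2 * M.+1 <= 2 ^ j)%N ->
  (2 * \sum_c lcount (slab c * g)%g (cball 0) <=
    #|{: 'M[F]_(n', M)}| * (2 + lcount g (cball 0)))%N.
Proof.
move=> n'0 Jl jM; rewrite sum_lcount_slab card_mx.
have p2 : (0 < 2 ^ j)%N by rewrite expn_gt0.
have n1 : (1 < n)%N by rewrite add1n ltnS.
rewrite -(leq_pmul2l p2).
have h : (2 ^ j * \sum_(v <- fset_set (glattice g `&` cball J%:Z)) #|slabs v| <=
    q ^ (n' * M) * (2 ^ j + M.+1 * lcount g (cball 0)))%N.
  rewrite (leq_trans (leq_mul (leqnn _) (sum_slabs_le g)))// mulnDr [leqRHS]mulnDr leq_add//.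
    by rewrite mulnC.
  rewrite big_distrr/= mulnCA.
  set X := (_ * lcount g _)%N.
  have -> : (M.+1 * X = \sum_(i < M.+1) X)%N by rewrite sum_nat_const card_ord.
  rewrite {}/X.
  apply: leq_sum => i _; rewrite mulnA.
  have h : ((lcount g (cball (i%:Z - j%:Z))).-1 * 2 ^ j <=
      q ^ (n' * i) * lcount g (cball 0))%N.
    exact: (@lcount_slab F n g j i n1 Jl (ltn_ord i)).
  rewrite [X in (X * _)%N]mulnC (leq_trans (leq_mul h (leqnn _)))//.
  rewrite mulnAC -expnD -mulnDr subnKC//; last by rewrite -ltnS.
rewrite mulnCA (leq_trans (leq_mul (leqnn 2) h))//.
rewrite mulnCA [X in (_ <= X)%N]mulnCA leq_mul//.
rewrite mulnDr [leqRHS]mulnDr; apply: leq_add; first by rewrite mulnC.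
by rewrite mulnA; apply: leq_mul.
Qed.

(** From exponent m on each step multiplies the count by exactly q^n, so the value known for large
    balls by [lcount_large] can be traced back to m. *)
Lemma leads_full_count (g : G) (m : nat) : leads g (m%:Z - 1) = [set: 'cV_n]%SET ->
  lcount g (cball m%:Z) = (q ^ (n * m.+1))%N.
Proof.
move=> gm; have [k0 /(_ (maxn k0 m)) hk] := lcount_large g isT.
have mul (e : nat) : lcount g (cball (m + e)%N%:Z) = (q ^ (n * e) * lcount g (cball m%:Z))%N.
  elim: e => [|e IH]; first by rewrite addn0 muln0 mul1n.
  rewrite (_ : (m + e.+1)%N%:Z = (m + e)%N%:Z + 1); last by lia.
  rewrite lcount_leads IH mulnS expnD mulnA; congr (_ * _ * _)%N.
  have -> : leads g (m + e)%N%:Z = [set: 'cV_n]%SET.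
    apply/eqP; rewrite -finset.subTset -gm; apply: leads_monoW.
    by lia.
  by rewrite cardsT card_mx muln1.
have := hk (leq_maxl _ _); rewrite -(subnKC (leq_maxr k0 m)) mul.
set e := (_ - _)%N.
have -> : (n * (m + e).+1 = n * e + n * m.+1)%N by rewrite -mulnDr; congr muln; lia.
rewrite expnD => /eqP; rewrite eqn_pmul2l; first by move=> /eqP.
by rewrite expn_gt0 (ltnW (card_gt1 F)).
Qed.

Lemma cusp_average_full (g : G) : leads g (J%:Z - 1) = [set: 'cV_n]%SET ->
  (\sum_c lcount (slab c * g)%g (cball 0) <=
    #|{: 'M[F]_(n', M)}| * q ^ (n * J.+1))%N.
Proof.
move=> gJ; rewrite -sum_nat_const; apply: leq_sum => c _.
rewrite -(leads_full_count gJ) lcount_slab_mx; apply: ncard_sub.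
  exact: glattice_finite.
exact: subIsetl.
Qed.

End CuspAverage.

(* This contraction of the height function g |-> #(g F[x]^n :&: O^n) is what
   prevents the mass from escaping into the cusp. *)
Lemma cusp_average (F : finFieldType) (n : nat) : (1 < n)%N ->
  exists (b : nat) (I : finType) (h : I -> SLinf F n), (0 < #|I|)%N /\
    forall g : SLinf F n, (2 * \sum_i lcount (h i * g)%g (cball 0) <=
      #|I| * (2 * b + lcount g (cball 0)))%N.
Proof.
case: n => [//|n']; rewrite ltnS => n'0.
(* With j = 4n and M = nj, one has 2(M + 1) = 8n^2 + 2 <= 16^n = 2^j. *)
pose j := (4 * n'.+1)%N.
exists (#|F| ^ (n'.+1 * (n' * j).+1))%N, 'M[F]_(n', (n'.+1 * j)), (@slab F n' j).
have q0 : (0 < #|F|)%N by apply: ltnW; exact: card_gt1.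
split; first by rewrite card_mx expn_gt0 q0.
move=> g; have [gJ|gJ] := eqVneq (leads g ((n' * j)%N%:Z - 1)) [set: 'cV_(1 + n')]%SET.
  have := leq_mul (leqnn 2) (cusp_average_full gJ) => /leq_trans; apply.
  by rewrite mulnCA leq_mul// leq_addr.
apply: leq_trans (cusp_average_slow n'0 gJ _) _.
  rewrite /j expnM; elim: (n') => // m IH; rewrite expnS.
  by have := leq_mul (leqnn 16) IH; lia.
by rewrite leq_mul// leq_add// -[X in (X <= _)%N]muln1 leq_mul// expn_gt0 q0.
Qed.

(** * Topology and measurability *)

Section MatrixTopology.
Variable F : finFieldType.
Local Notation K := (laurent F).
Local Notation qQ := (#|F|%:R : rat).

Lemma ball_lbnd (e : rat) : 0 < e ->
  exists k, forall a b : K, lbnd (b - a) k -> ball a e b.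
Proof.
move=> e0; have q1 : 1 < qQ by rewrite -[1]/(1%:R) ltr_nat card_gt1.
have q0 := qQ_gt0 F.
exists (- (Num.bound e^-1)%:Z) => a b /labs_le ab.
rewrite /ball/= /ldist -labsN opprB (le_lt_trans ab)//.
rewrite -invr_expz -[ltRHS]invrK ltf_pV2 ?posrE ?exprz_gt0 ?invr_gt0//.
rewrite -exprnP (lt_trans (archi_boundP _)) ?invr_ge0 ?ltW// -natrX ltr_nat.
exact: ltn_expl (card_gt1 F).
Qed.

Lemma open_mxP p r (B : set 'M[K]_(p, r)) : open B <->
  forall x, B x -> exists k, forall y, (forall i j, lbnd ((y - x) i j) k) -> B y.
Proof.
rewrite openE; split=> [oB x /oB|h x /h[k kB]].
  move/nbhs_ballP => [e /= e0 eB]; have [k kb] := ball_lbnd e0; exists k => y yk.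
  by apply: eB; split=> // i j; apply: kb; have := yk i j; rewrite !mxE.
apply/nbhs_ballP; exists (qQ ^ k) => /=; first by rewrite exprz_gt0// qQ_gt0.
move=> y [_ yk]; apply: kB => i j; rewrite !mxE; apply/labs_le.
by have := yk i j; rewrite /ball/= /ldist -labsN opprB => /ltW.
Qed.

Lemma mx_lbnd_trans p r (x y z : 'M[K]_(p, r)) k :
  (forall i j, lbnd ((y - x) i j) k) -> (forall i j, lbnd ((z - y) i j) k) ->
  forall i j, lbnd ((z - x) i j) k.
Proof.
move=> yx zy i j; rewrite -(subrKA y) mxE; exact: (lbndD (zy i j) (yx i j)).
Qed.

Variable n : nat.
Local Notation G := (SLinf F n).

(** The required open set of matrices is the union of the balls around points of S whose trace on G
    lies in S. *)
Lemma open_SLP (S : set G) : open S <->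
  forall g, S g -> exists k, forall g' : G,
    (forall i j, lbnd ((slmx g' - slmx g) i j) k) -> S g'.
Proof.
split=> [[B /open_mxP oB <-] g /oB[k kB]|h].
  by exists k => g' gk; apply: kB.
exists [set x | exists2 k, (exists2 g, S g &
    (forall i j, lbnd ((x - slmx g) i j) k) /\
    (forall g' : G, (forall i j, lbnd ((slmx g' - slmx g) i j) k) -> S g')) & True].
  apply/open_mxP => x [k [g Sg [xg gk]] _]; exists k => y yx.
  by exists k => //; exists g => //; split=> //; exact: mx_lbnd_trans xg yx.
apply/seteqP; split=> [g /= [k [g0 _ [gg0 g0k]] _]|g Sg]; first exact: g0k.
have [k gk] := h g Sg; exists k => //; exists g => //; split=> // i j.
by rewrite subrr mxE.
Qed.

Lemma mulmx_bndr m p (A : 'M[K]_(m, p)) : exists N : int, 0 <= N /\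
  forall r k (B : 'M[K]_(r, m)), (forall i j, lbnd (B i j) k) ->
    forall i j, lbnd ((B *m A) i j) (N + k).
Proof.
have [N [N0 h]] := mulmx_bnd A^T; exists N; split=> // r k B Bk i j.
have -> : (B *m A) i j = (B *m A)^T j i by rewrite [RHS]mxE.
rewrite trmx_mul.
by apply: h => i' j'; rewrite mxE.
Qed.

Definition near1 (h : G) k := forall i j, lbnd ((slmx h - 1%:M) i j) k.

(** If g' is close to g, then g' = (g' g^(-1)) g with g' g^(-1) close to 1. Thus a function on
    lattices that is invariant under a neighbourhood of 1 is locally constant. *)
Lemma open_lattice_space (U : set (lattice_space F n)) k :
  (forall h l, near1 h k -> U l -> U (lact h l)) -> open U.
Proof.
move=> hU; change (open (@lclass F n @^-1` U)).
apply/open_SLP => g Ug; have [N [N0 gN]] := mulmx_bndr (slmx g^-1%g).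
exists (k - N) => g' gg'.
have -> : g' = (g' * g^-1 * g)%g by rewrite -mulgA mulVg mulg1.
have := hU (g' * g^-1)%g (lclass g); rewrite lact_class; apply=> //.
move=> i j; have := gN _ _ _ gg' i j; rewrite mulmxBl slmxK.
by rewrite [N + _]addrC subrK.
Qed.

Lemma measurable_open (T : ptopologicalType) (A : set (borel T)) :
  open (A : set T) -> measurable A.
Proof. exact: sub_sigma_algebra. Qed.

Lemma measurable_lact (h : G) : measurable_fun [set: borel (lattice_space F n)]
  (lact h : borel (lattice_space F n) -> borel (lattice_space F n)).
Proof.
refine (@measurability _ _ (borel (lattice_space F n)) (borel (lattice_space F n))
  setT (lact h) (@open (lattice_space F n)) erefl _).
move=> _ [U oU <-]; rewrite setTI; apply: measurable_open.
change (open (@lclass F n @^-1` (lact h @^-1` U))).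
have : open (@lclass F n @^-1` U) by exact: oU.
move=> /open_SLP oU'; apply/open_SLP => g /=.
rewrite lact_class => /oU'[k kU]; have [N [N0 hN]] := mulmx_bnd (slmx h).
exists (k - N) => g' gg'; rewrite lact_class; apply: kU => i j.
by rewrite -mulmxBr; have := hN _ _ _ gg' i j; rewrite [N + _]addrC subrK.
Qed.

Lemma near1_mul h k l v : near1 h k -> cball l v ->
  cball (k + l) (slmx h *m v - v).
Proof.
move=> h1 /cballP vl; rewrite -[X in _ - X]mul1mx -mulmxBl; apply/cballP => i.
by rewrite mxE; apply: lbnd_sum => s _; exact: (lbndM (h1 i s) (vl s)).
Qed.

(** The vector hv - v is shorter than v by a factor q at least. For the direct implication, a ball
    known to contain v shrinks one exponent at a time. *)
Lemma near1_isom h l v : near1 h (-1) -> cball l (slmx h *m v) <-> cball l v.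
Proof.
move=> h1; split=> vl; last first.
  rewrite -[_ *m _](subrK v _); apply: cballD => //.
  by apply: cballW (near1_mul h1 vl); lia.
have [k vk] := col_bnd v.
have {k vk} : exists m : nat, cball (l + m%:Z) v.
  by exists (absz (k - l)%R); apply: cballW vk; lia.
move=> [m]; elim: m => [|m IH]; first by rewrite addr0.
move=> vm; apply: IH; have := near1_mul h1 vm => hv.
rewrite -[v](subKr (slmx h *m v)); apply: cballB.
  by apply: cballW vl; lia.
by apply: cballW hv; lia.
Qed.

(** On a ball of radius q^N containing the box, h moves points by less than the smallest side of the
    box; as an isometry, h brings no point into that ball from outside. *)
Lemma near1_box (u : 'cV[K]_n) (k : 'I_n -> int) :
  exists l, forall h v, near1 h l -> box u k (slmx h *m v) <-> box u k v.
Proof.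
have [N boxN] := box_bnd u k.
pose S := \sum_i `|k i|.
have S0 : 0 <= S by apply: sumr_ge0.
have kS i : - S <= k i.
  have : `|k i| <= S by rewrite /S (bigD1 i)//= lerDl sumr_ge0.
  by lia.
exists (-1 - S - N%:Z) => h v h1.
have h2 : near1 h (-1) by move=> i j; apply: lbndW (h1 i j); lia.
have key : cball N%:Z v -> forall i, lbnd ((slmx h *m v) i 0 - v i 0) (k i).
  move=> vN i; have /cballP/(_ i) := near1_mul h1 vN.
  by rewrite !mxE; apply: lbndW; have := kS i; lia.
split=> vb i.
  have vN : cball N%:Z v by apply/(near1_isom _ _ h2); exact: boxN.
  rewrite (_ : _ - _ = ((slmx h *m v) i 0 - u i 0) -
                       ((slmx h *m v) i 0 - v i 0)); last by ring.
  exact: (lbndB (vb i) (key vN i)).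
rewrite (_ : _ - _ = ((slmx h *m v) i 0 - v i 0) + (v i 0 - u i 0));
  last by ring.
exact: (lbndD (key (boxN _ vb) i) (vb i)).
Qed.

End MatrixTopology.

(** * Counts of nonzero lattice points in boxes *)

Section PuncturedCounts.
Variables (F : finFieldType) (n : nat).
Local Notation K := (laurent F).
Local Notation G := (SLinf F n).
Local Notation q := (#|F|).
Implicit Types (A : set 'cV[K]_n) (l : lattice_space F n) (h : G).

(** For a box A this is the Siegel transform of its indicator. *)
Definition pcount A l : nat := ncard ((lattice l `&` A) `\ 0).

Lemma lattice_finite_box l u (k : 'I_n -> int) :
  finite_set (lattice l `&` box u k).
Proof. exact: glattice_finite_box. Qed.

Lemma pcount_act u u' (k k' : 'I_n -> int) h l :
  (forall v, box u' k' (slmx h *m v) <-> box u k v) ->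
  pcount (box u' k') (lact h l) = pcount (box u k) l.
Proof.
move=> hb; rewrite /pcount lattice_act -[RHS](ncard_image _ (@slmx_inj _ _ h)).
  congr ncard; apply/seteqP; split.
    move=> _ [[[v lv <-] vb] v0]; exists v => //; split.
      by split=> //; apply/hb.
    by apply: contra_not v0 => /= ->; rewrite mulmx0.
  move=> _ [v [[lv vb] v0] <-]; split.
    by split; [exists v | apply/hb].
  by move=> /= hv; apply: v0; apply: (@slmx_inj _ _ h); rewrite hv mulmx0.
exact/finite_setD/lattice_finite_box.
Qed.

Lemma pcount_refine u (k : 'I_n -> int) j l : pcount (box u (kbump k j)) l =
  (\sum_a pcount (box (u + cshift j (k j + 1)%R a)%R k) l)%N.
Proof.
rewrite /pcount (@ncard_fibers _ _ _ (fun v : 'cV[K]_n => (v j 0 - u j 0) (k j + 1))).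
  apply: eq_bigr => a _; congr ncard; apply/seteqP; split=> v.
    move=> [[[lv vb] v0] va]; split=> //; split=> //.
    by apply/box_refine.
  by move=> [[lv /box_refine[vb va]] v0].
exact/finite_setD/lattice_finite_box.
Qed.

Lemma pcount_split (k : int) d l : pcount (cball (k + d%:Z)) l =
  (\sum_(c : 'M[F]_(n, d)) pcount (box (csers (k + 1)%R c) (fun=> k)) l)%N.
Proof.
rewrite /pcount (@ncard_fibers _ _ _ (fun v : 'cV[K]_n =>
  \matrix_(i < n, m < d) v i 0 (k + 1 + m%:Z))).
  apply: eq_bigr => c _; congr ncard; apply/seteqP; split=> v.
    move=> [[[lv vb] v0] va]; split=> //; split=> //.
    by apply/box_csers; split.
  by move=> [[lv /box_csers[vb va]] v0].
exact/finite_setD/lattice_finite_box.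
Qed.

Lemma pcount_lcount k l : lcount (repr l) (cball k) = (pcount (cball k) l).+1.
Proof.
rewrite /lcount /pcount /ncard -latticeE.
have X0 : 0 \in fset_set (lattice l `&` cball k).
  rewrite in_fset_set; last exact: lattice_finite_box.
  by apply/mem_set; split; [exact: glattice0|exact: cball_0].
rewrite (cardfsD1 0) X0 add1n; congr (_.+1); congr #|` _|.
rewrite fset_setD ?fset_set1//; exact: lattice_finite_box.
Qed.

Lemma lcount_act h l A : lcount (repr (lact h l)) A = lcount (h * repr l)%g A.
Proof. by rewrite /lcount -latticeE /lact lattice_class. Qed.

Lemma lcount_lipschitz (g : G) (k e : nat) :
  (lcount g (cball (k + e)%N%:Z) <= q ^ (n * e) * lcount g (cball k%:Z))%N.
Proof.
elim: e => [|e IH]; first by rewrite addn0 muln0 mul1n.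
rewrite (_ : (k + e.+1)%N%:Z = (k + e)%N%:Z + 1); last by lia.
rewrite lcount_leads mulnS expnD -mulnA leq_mul//.
by rewrite (leq_trans (max_card _))// card_mx muln1.
Qed.

Lemma pcount_cusp (N : nat) l :
  (2 ^ N * pcount (cball (- N%:Z)) l <= lcount (repr l) (cball 0))%N.
Proof.
have [->|] := posnP (pcount (cball (- N%:Z)) l); first by rewrite muln0.
move=> p0; have [v [[lv vb] v0]] : (lattice l `&` cball (- N%:Z)) `\ 0 !=set0.
  apply/set0P/eqP => e; move: p0; rewrite /pcount e /ncard fset_set0.
  by rewrite cardfs0.
have := lcount_fast N lv vb; rewrite addNr => /(_ ltac:(exact/eqP)).
by apply: leq_trans; rewrite leq_mul// pcount_lcount.
Qed.

Lemma pcount_box_le u (k : 'I_n -> int) : exists C : nat, forall l,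
  (pcount (box u k) l <= C * lcount (repr l) (cball 0))%N.
Proof.
have [M kM] := box_bnd u k; exists (q ^ (n * M))%N => l.
apply: (@leq_trans (lcount (repr l) (cball M%:Z))).
  apply: ncard_sub; first exact: glattice_finite.
  by move=> v [[lv vb] _]; split=> //; exact: kM.
exact: (lcount_lipschitz (repr l) 0 M).
Qed.

(** The count is locally constant by [near1_box], so the preimage of any set is open, whatever f and
    its target. *)
Lemma measurable_pcount d (T : measurableType d) u (k : 'I_n -> int) (f : nat -> T) :
  measurable_fun [set: borel (lattice_space F n)] (fun l => f (pcount (box u k) l)).
Proof.
have [e he] := near1_box u k => _ Y _; rewrite setTI; apply: measurable_open.
apply: (@open_lattice_space _ _ _ e) => h l h1 /=.
by rewrite (@pcount_act u u k k h) // => v; exact: he.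
Qed.

End PuncturedCounts.

(** * Integrability of lattice counts *)

Section RintegralSum.
Variables (d : measure_display) (T : measurableType d) (R : realType).
Variable mu : {measure set T -> \bar R}.

Lemma integrable_Rsum (I : finType) (X : I -> T -> R) :
  (forall i, mu.-integrable setT (EFin \o X i)) ->
  mu.-integrable setT (EFin \o (fun x => \sum_i X i x)).
Proof.
move=> iX; apply: (eq_integrable _ (fun x => \sum_i (X i x)%:E)%E) => //.
  by move=> x _; rewrite /= sumEFin.
by apply: integrable_sum => // i _; exact: iX.
Qed.

Lemma Rintegral_sum (I : finType) (X : I -> T -> R) :
  (forall i, mu.-integrable setT (EFin \o X i)) ->
  \int[mu]_x (\sum_i X i x) = \sum_i \int[mu]_x X i x.
Proof.
move=> iX; elim: (index_enum I) => [|i s IH].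
  rewrite big_nil; under eq_Rintegral do rewrite big_nil.
  by rewrite /Rintegral integral0.
rewrite big_cons -IH; under eq_Rintegral do rewrite big_cons.
apply: RintegralD => //.
apply: (eq_integrable _ (fun x => \sum_(j <- s) (X j x)%:E)%E) => //.
  by move=> x _; rewrite /= sumEFin.
by apply: integrable_sum => // j _; exact: iX.
Qed.

Lemma integrable_RsumZ (I : finType) (r : I -> R) (X : I -> T -> R) :
  (forall i, mu.-integrable setT (EFin \o X i)) ->
  mu.-integrable setT (EFin \o (fun x => \sum_i r i * X i x)).
Proof.
move=> iX; apply: (@integrable_Rsum _ (fun i x => r i * X i x)) => i.
exact: (integrableZl measurableT (r i) (iX i)).
Qed.

Lemma Rintegral_sumZ (I : finType) (r : I -> R) (X : I -> T -> R) :
  (forall i, mu.-integrable setT (EFin \o X i)) ->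
  \int[mu]_x (\sum_i r i * X i x) = \sum_i r i * \int[mu]_x X i x.
Proof.
move=> iX; rewrite (@Rintegral_sum _ (fun i x => r i * X i x)).
  by apply: eq_bigr => i _; exact: RintegralZl.
by move=> i; exact: (integrableZl measurableT (r i) (iX i)).
Qed.

End RintegralSum.

Lemma Rintegral_cst_probability d (T : measurableType d) (R : realType)
  (P : probability T R) (r : R) : \int[P]_(_ in [set: T]) r = r.
Proof.
rewrite Rintegral_cst//; transitivity (r * fine 1%E); last by rewrite mulr1.
by congr (r * fine _); exact: probability_setT.
Qed.

Section Integrability.
Variables (R : realType) (F : finFieldType) (n : nat).
Local Notation K := (laurent F).
Local Notation G := (SLinf F n).
Local Notation q := (#|F|).
Local Notation LS := (borel (lattice_space F n)).
Variable m : probability LS R.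
Hypothesis m_inv : lattice_measure_invariant m.

Lemma lact1 (l : lattice_space F n) : lact 1%g l = l.
Proof. by rewrite /lact mul1g lclassK. Qed.

Lemma lactM (g h : G) (l : lattice_space F n) : lact g (lact h l) = lact (g * h)%g l.
Proof. by rewrite -(lclassK l) !lact_class mulgA. Qed.

(** Invariance is stated for images; the preimage of A under h is its image under h^(-1). *)
Lemma ge0_integral_lact (h : G) (f : LS -> \bar R) :
  measurable_fun [set: LS] f -> (forall l, 0 <= f l)%E ->
  (\int[m]_l f (lact h l) = \int[m]_l f l)%E.
Proof.
move=> mf f0; have mh := measurable_lact h.
rewrite -[LHS](ge0_integral_pushforward mh m measurableT mf) => [|l _]; last exact: f0.
apply: eq_measure_integral => A mA _.
rewrite /pushforward -[RHS](m_inv (h^-1)%g)//; congr (m _).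
apply/seteqP; split=> [l /= Ahl|_ [l Al <-] /=].
  by exists (lact h l) => //; rewrite lactM mulVg lact1.
by rewrite lactM mulgV lact1.
Qed.

Let H (l : LS) : R := (pcount (cball 0) l).+1%:R.

Lemma HE (l : LS) : H l = (lcount (repr l) (cball 0))%:R.
Proof. by rewrite pcount_lcount. Qed.

Lemma integrable_bounded_pcount u (k : 'I_n -> int) (f : nat -> R) (C : R) :
  (forall i, `|f i| <= C) ->
  m.-integrable setT (fun l : LS => (f (pcount (box u k) l))%:E).
Proof.
move=> fC; apply: (le_integrable measurableT (g := EFin \o cst C)).
- by apply/measurable_EFinP; exact: measurable_pcount.
- by move=> l _ /=; rewrite lee_fin (le_trans (fC _))// ler_norm.
- exact: finite_measure_integrable_cst.
Qed.

Lemma Rintegral_lact (h : G) u (k : 'I_n -> int) (f : nat -> R) :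
  (forall i, 0 <= f i) ->
  \int[m]_l f (pcount (box u k) (lact h l)) = \int[m]_l f (pcount (box u k) l).
Proof.
move=> f0; rewrite /Rintegral.
rewrite (ge0_integral_lact h (f := fun l => (f (pcount (box u k) l))%:E))//.
  by apply/measurable_EFinP; exact: measurable_pcount.
by move=> l; rewrite lee_fin.
Qed.

Hypothesis n1 : (1 < n)%N.

(* Invariance of m turns the averaged inequality [cusp_average] into an a
   priori bound, after truncation at height t to make all integrals finite. *)
Lemma truncated_integral_bound : exists b : R, forall t : nat,
  \int[m]_l (if (pcount (cball 0) l < t)%N then H l else 0) <= b.
Proof.
have [b [I [h [I0 hb]]]] := cusp_average F n1.
exists (2 * b%:R) => t.
(* In terms of H = p + 1, [psi] is min(H, t), and [chi] is H where H <= t and 0 elsewhere. The mean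
   of [psi] over the h_i, plus [chi]/2, is at most [psi] + b: by [cusp_average] where H <= t, and
   because [psi] = t elsewhere. After integration the [psi] terms cancel by invariance and leave 2b
   as a bound. *)
pose psi (p : nat) : R := Num.min p.+1%:R t%:R.
pose chi (p : nat) : R := if (p < t)%N then p.+1%:R else 0.
rewrite -[leLHS]/(\int[m]_l chi (pcount (cball 0) l)).
have psi0 p : 0 <= psi p by rewrite le_min !ler0n.
have psit p : psi p <= t%:R by rewrite ge_min lexx orbT.
have chi0 p : 0 <= chi p by rewrite /chi; case: ifP.
have chit p : chi p <= t%:R by rewrite /chi; case: ifP => // pt; rewrite ler_nat.
have psi_le p : psi p <= p.+1%:R by rewrite ge_min lexx.
have psi_lo p : (p < t)%N -> psi p = p.+1%:R by move=> pt; apply/min_idPl; rewrite ler_nat.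
have psi_hi p : (t <= p)%N -> psi p = t%:R.
  by move=> tp; apply/min_idPr; rewrite ler_nat ltnW.
have chi_lo p : (p < t)%N -> chi p = p.+1%:R by rewrite /chi => ->.
have chi_hi p : (t <= p)%N -> chi p = 0 by rewrite /chi ltnNge => ->.
have ipsi : m.-integrable setT (fun l : LS => (psi (pcount (cball 0) l))%:E).
  by apply: (@integrable_bounded_pcount _ _ _ t%:R) => i; rewrite ger0_norm.
have ichi : m.-integrable setT (fun l : LS => (chi (pcount (cball 0) l))%:E).
  by apply: (@integrable_bounded_pcount _ _ _ t%:R) => i; rewrite ger0_norm.
have ipsih g : m.-integrable setT
    (fun l : LS => (psi (pcount (cball 0) (lact g l)))%:E).
  apply: (le_integrable measurableT (g := EFin \o cst t%:R)).
  - apply/measurable_EFinP; apply: (measurableT_comp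
      (f := fun l : LS => psi (pcount (cball 0) l)) _ (measurable_lact g)).
    exact: measurable_pcount.
  - by move=> l _ /=; rewrite lee_fin !ger0_norm.
  - exact: finite_measure_integrable_cst.
pose N : R := #|I|%:R.
have N0 : 0 < N by rewrite ltr0n.
have key (l : LS) : \sum_i psi (pcount (cball 0) (lact (h i) l)) +
    N / 2 * chi (pcount (cball 0) l) <= N * psi (pcount (cball 0) l) + N * b%:R.
  have hl : 2 * \sum_i (pcount (cball 0) (lact (h i) l)).+1%:R <=
      N * (2 * b%:R + H l).
    have := hb (repr l); rewrite -(ler_nat R) natrM natr_sum.
    under eq_bigr do rewrite -lcount_act pcount_lcount.
    by rewrite natrM natrD natrM pcount_lcount.
  rewrite /H in hl; set p := pcount _ l in hl *.
  have [pt|tp] := ltnP p t.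
    rewrite psi_lo// chi_lo//.
    have : \sum_i psi (pcount (cball 0) (lact (h i) l)) <=
        \sum_i (pcount (cball 0) (lact (h i) l)).+1%:R.
      by apply: ler_sum => i _; exact: psi_le.
    move: hl; set S1 := \sum_i _; set S2 := \sum_i _; move: S1 S2 (p.+1%:R : R) => S1 S2 x.
    by move=> *; lra.
  rewrite psi_hi// chi_hi// mulr0 addr0.
  have : \sum_i psi (pcount (cball 0) (lact (h i) l)) <= \sum_(i : I) t%:R.
    by apply: ler_sum => i _; exact: psit.
  rewrite sumr_const -(mulr_natl t%:R) => /le_trans; apply.
  by rewrite lerDl mulr_ge0// ltW.
clearbody psi chi.
have iS : m.-integrable setT
    (EFin \o (fun l : LS => \sum_i psi (pcount (cball 0) (lact (h i) l)))).
  by apply: (integrable_Rsum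
    (X := fun i (l : LS) => psi (pcount (cball 0) (lact (h i) l)))) => i; exact: ipsih.
have iC : m.-integrable setT
    (EFin \o (fun l : LS => N / 2 * chi (pcount (cball 0) l))).
  exact: (integrableZl measurableT _ ichi).
have iP : m.-integrable setT
    (EFin \o (fun l : LS => N * psi (pcount (cball 0) l))).
  exact: (integrableZl measurableT _ ipsi).
have iB : m.-integrable setT (EFin \o (fun l : LS => N * b%:R)).
  exact: finite_measure_integrable_cst.
have := le_Rintegral measurableT (integrableD measurableT iS iC)
  (integrableD measurableT iP iB) (fun l _ => key l).
rewrite (RintegralD measurableT iS iC) (RintegralD measurableT iP iB).
rewrite (Rintegral_sum (X := fun i (l : LS) => psi (pcount (cball 0) (lact (h i) l))));
  last by move=> i; exact: ipsih.
rewrite (RintegralZl (f := fun l : LS => chi (pcount (cball 0) l)) _ measurableT ichi).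
rewrite (RintegralZl (f := fun l : LS => psi (pcount (cball 0) l)) _ measurableT ipsi).
rewrite Rintegral_cst_probability.
under eq_bigr do rewrite Rintegral_lact//.
rewrite sumr_const -(mulr_natl (Rintegral _ _ _)) -/N -/(cball _ _).
move: (Rintegral _ _ (fun l => psi _)) (Rintegral _ _ (fun l => chi _)) => a c.
rewrite lerD2l mulrAC -mulrA ler_pM2l// => ac.
by move: ac; lra.
Qed.

(** The truncations increase to H, so their uniform bound passes to H by monotone convergence. *)
Lemma integrable_H : m.-integrable setT (fun l => (H l)%:E).
Proof.
have [b hb] := truncated_integral_bound.
pose chi (t p : nat) : R := if (p < t)%N then p.+1%:R else 0.
have chi0 t p : 0 <= chi t p by rewrite /chi; case: ifP.
apply/integrableP; split.
  by apply/measurable_EFinP; exact: (measurable_pcount 0 (fun=> 0) (fun p => p.+1%:R : R)).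
have := @cvg_monotone_convergence _ _ _ m setT measurableT
  (fun t l => (chi t (pcount (cball 0) l))%:E).
move=> /(_ _ _ _)/wrap[].
- by move=> t; apply/measurable_EFinP; exact: measurable_pcount.
- by move=> t l _; rewrite lee_fin.
- move=> l _ t t' tt'; rewrite lee_fin /chi; case: ifPn => [h|_]; last exact: chi0.
  by rewrite (leq_trans h).
have limE (l : LS) : limn (fun t => (chi t (pcount (cball 0) l))%:E) = (H l)%:E.
  apply/cvg_lim => //; apply: cvg_near_cst.
  exists (pcount (cball 0) l).+1 => // t /= pt.
  by rewrite /chi pt.
under eq_integral do rewrite limE.
move=> cvgH; rewrite (eq_integral (fun l => (H l)%:E)); last first.
  by move=> l _; rewrite gee0_abs// lee_fin.
rewrite -(cvg_lim _ cvgH)//; apply: (@le_lt_trans _ _ b%:E); last exact: ltry.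
apply: lime_le; first by apply/cvg_ex; eexists; exact: cvgH.
apply: nearW => t; have := hb t; rewrite -lee_fin fineK//.
apply: integrable_fin_num => //.
apply: (@integrable_bounded_pcount _ _ (chi t) t%:R) => i.
by rewrite ger0_norm// /chi; case: ifP => // it; rewrite ler_nat.
Qed.

Lemma integrable_pcount u (k : 'I_n -> int) :
  m.-integrable setT (fun l : LS => (pcount (box u k) l)%:R%:E).
Proof.
have [C hC] := pcount_box_le u k.
apply: (le_integrable measurableT (g := fun l => C%:R%:E * (H l)%:E)%E).
- by apply/measurable_EFinP; exact: (measurable_pcount u k (fun p => p%:R : R)).
- move=> l _; rewrite -EFinM /= lee_fin !ger0_norm ?mulr_ge0//.
  by rewrite HE -natrM ler_nat.
- exact: integrableZl integrable_H.
Qed.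

End Integrability.

(** * The intensity measure of a random lattice *)

Section BoxMass.
Variables (R : realType) (F : finFieldType) (n : nat).
Local Notation K := (laurent F).
Local Notation G := (SLinf F n).
Local Notation q := (#|F|).
Local Notation qR := (#|F|%:R : R).
Local Notation LS := (borel (lattice_space F n)).
Variable m : probability LS R.
Hypothesis m_inv : lattice_measure_invariant m.
Hypothesis n1 : (1 < n)%N.
Implicit Types (u v : 'cV[K]_n).

Definition mass u (k : 'I_n -> int) : R := \int[m]_l (pcount (box u k) l)%:R.

Lemma mass_inv (h : G) u u' (k k' : 'I_n -> int) :
  (forall v, box u' k' (slmx h *m v) <-> box u k v) -> mass u' k' = mass u k.
Proof.
move=> hb; rewrite /mass -(Rintegral_lact m_inv h u' k' (f := fun p => p%:R))//.
by apply: eq_Rintegral => l _; rewrite (pcount_act l hb).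
Qed.

Lemma mass_refine u (k : 'I_n -> int) j :
  mass u (kbump k j) = \sum_a mass (u + cshift j (k j + 1) a) k.
Proof.
rewrite /mass.
rewrite -(Rintegral_sum (X := fun a (l : LS) =>
  (pcount (box (u + cshift j (k j + 1) a) k) l)%:R)).
  by apply: eq_Rintegral => l _; rewrite pcount_refine natr_sum.
by move=> a; exact: integrable_pcount.
Qed.

Lemma mass_split (k : int) : mass 0 (fun=> k + 1) =
  \sum_(c : 'M[F]_(n, 1)) mass (csers (k + 1) c) (fun=> k).
Proof.
rewrite /mass.
rewrite -(Rintegral_sum (X := fun c (l : LS) =>
  (pcount (box (csers (k + 1) c) (fun=> k)) l)%:R)).
  by apply: eq_Rintegral => l _; rewrite -natr_sum -pcount_split.
by move=> a; exact: integrable_pcount.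
Qed.

Definition transvection (i j : 'I_n) (c : K) : 'M[K]_n := 1%:M + c *: delta_mx j i.

Lemma transvection_mul i j c v a :
  (transvection i j c *m v) a 0 = v a 0 + (a == j)%:R * (c * v i 0).
Proof.
rewrite /transvection mulmxDl mul1mx mxE -scalemxAl mxE; congr (_ + _).
rewrite mulrCA; congr (_ * _); rewrite mxE (bigD1 i)//= mxE eqxx andbT big1 ?addr0//.
by move=> b /negPf bi; rewrite mxE bi andbF mul0r.
Qed.

Lemma transvection_det i j c : i != j -> labs (\det (transvection i j c)) = 1.
Proof.
move=> ij; suff -> : \det (transvection i j c) = 1 by rewrite labs1.
wlog : i j ij / (i < j)%N => [H|lij].
  have [lij|lji|/val_inj eij] := ltngtP i j; [exact: H| |by rewrite eij eqxx in ij].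
  rewrite -det_tr (_ : _^T = transvection j i c); first by apply: H => //; rewrite eq_sym.
  by apply/matrixP => a b; rewrite !mxE [b == a]eq_sym [(b == j) && _]andbC.
rewrite det_trig.
  apply: big1 => a _; rewrite !mxE eqxx; case: eqP => [->|_]; last first.
    by rewrite mulr0 addr0.
  by rewrite [j == i]eq_sym (negPf ij) mulr0 addr0.
apply/is_trig_mxP => a b ab; rewrite !mxE.
have -> : (a == b) = false by apply/negbTE; rewrite -val_eqE/= neq_ltn ab.
rewrite add0r; case: eqP => [aj|_]; last by rewrite mulr0.
case: eqP => [bi|_]; last by rewrite mulr0.
by move: ab; rewrite aj bi ltnNge ltnW.
Qed.

Definition dilation (i : 'I_n) (r : K) : 'M[K]_n :=
  diag_mx (\row_a (if a == i then r else 1)).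

Lemma dilation_mul i r v a :
  (dilation i r *m v) a 0 = (if a == i then r else 1) * v a 0.
Proof. by rewrite mul_diag_mx !mxE. Qed.

Lemma dilation_det i r : labs r = 1 -> labs (\det (dilation i r)) = 1.
Proof.
move=> r1; rewrite det_diag (bigD1 i)//= mxE eqxx big1 ?mulr1// => a /negPf ai.
by rewrite mxE ai.
Qed.

Lemma lbnd_labsM (r x : K) k : labs r = 1 -> lbnd (r * x) k <-> lbnd x k.
Proof. by move=> r1; split=> /labs_le h; apply/labs_le; move: h; rewrite labsM r1 mul1r. Qed.

Lemma labs_1D (x : K) : lbnd x (-1) -> labs (1 + x) = 1.
Proof.
move=> x1; have d : is_ldeg (1 + x) 0.
  split; first by rewrite lcoefD lcoef1 x1// addr0 oner_eq0.
  by move=> i i0; rewrite lcoefD lcoef1 x1 ?addr0; [rewrite gt_eqF|lia].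
rewrite /labs (ldeg_uniq d) expr0z; case: eqP => // e0.
by case: d; rewrite e0 lcoef0 eqxx.
Qed.

(* Translating a box that misses the hyperplane [v_i = 0] in the direction j
   is the effect of a transvection if j <> i, of a dilation if j = i. *)
Lemma mass_shift u (k : 'I_n -> int) i j a : ~ lbnd (u i 0) (kbump k j i) ->
  mass (u + cshift j (k j + 1) a) k = mass u k.
Proof.
move=> ui; have ui0 : u i 0 != 0 by apply: contra_notN ui => /eqP ->; exact: lbnd0.
(* The multiplier s / u_i turns u into u + s e_j. Its degree is at most k j - k i if j <> i, and at
   most -1 if j = i, so the shape of the box is preserved. *)
pose s : K := lser (k j + 1) (fun _ : 'I_1 => a).
have sb : lbnd s (k j + 1) by apply: lbndW (lbnd_ser _); lia.
have uV := lbnd_inv ui0 ui.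
have sE : s / u i 0 * u i 0 = s by rewrite divfK.
have [ji|ij] := eqVneq j i.
  subst j; rewrite /kbump eqxx in uV.
  have sub1 : lbnd (s / u i 0) (-1) by apply: lbndW (lbndM sb uV); lia.
  have r1 := labs_1D sub1.
  apply: (@mass_inv (mkSL (dilation_det i r1))) => v /=.
  have E b : (dilation i (1 + s / u i 0) *m v) b 0 - (u + cshift i (k i + 1) a) b 0 =
      (if b == i then 1 + s / u i 0 else 1) * (v b 0 - u b 0).
    rewrite dilation_mul !mxE; case: eqP => [->|_]; last by rewrite !mul1r addr0.
    by rewrite -/s mulrBr [(1 + _) * u i 0]mulrDl sE mul1r.
  split=> vb b; have := vb b; rewrite E; case: eqP => _; rewrite ?mul1r//;
    by move/(lbnd_labsM _ _ r1).
have ij' : i != j by rewrite eq_sym.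
rewrite /kbump (negPf ij') addr0 in uV.
apply: (@mass_inv (mkSL (transvection_det (s / u i 0) ij'))) => v /=.
have E b : (transvection i j (s / u i 0) *m v) b 0 - (u + cshift j (k j + 1) a) b 0 =
    (v b 0 - u b 0) + (b == j)%:R * (s / u i 0 * (v i 0 - u i 0)).
  rewrite transvection_mul !mxE; case: eqP => [->|_]; last first.
    by rewrite !mul0r !addr0.
  by rewrite -/s !mul1r mulrBr sE; ring.
have small x : lbnd x (k i) -> lbnd (s / u i 0 * x) (k j).
  by move=> xk; apply: lbndW (lbndM (lbndM sb uV) xk); lia.
have Ei : (transvection i j (s / u i 0) *m v) i 0 - (u + cshift j (k j + 1) a) i 0 =
   v i 0 - u i 0 by rewrite E (negPf ij') mul0r addr0.
split=> vb b.
  have := vb b; rewrite E; case: eqP => [->|_]; last by rewrite mul0r addr0.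
  rewrite mul1r => h; rewrite -[v j 0 - u j 0](addrK (s / u i 0 * (v i 0 - u i 0))).
  by apply: lbndB => //; apply: small; rewrite -Ei.
rewrite E; case: eqP => [->|_]; last by rewrite mul0r addr0.
by rewrite mul1r; apply: lbndD => //; exact: small.
Qed.

(** Mass per unit of volume. *)
Definition dens u (k : 'I_n -> int) : R := mass u k * qR ^ (- \sum_i k i).

Lemma qR_neq0 : qR != 0.
Proof. by rewrite pnatr_eq0 -lt0n ltnW// card_gt1. Qed.

(** The larger box consists of q translates, which have the same mass by [mass_shift]. *)
Lemma dens_step u (k : 'I_n -> int) i j : ~ lbnd (u i 0) (kbump k j i) ->
  dens u (kbump k j) = dens u k.
Proof.
move=> ui; rewrite /dens mass_refine (eq_bigr (fun=> mass u k)); last first.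
  by move=> a _; exact: mass_shift ui.
rewrite sumr_const kbump_sum -(mulr_natl (mass u k)) [_ * mass u k]mulrC -mulrA.
congr (_ * _); rewrite opprD expfzDr ?qR_neq0// mulrC -mulrA.
by rewrite -[_ ^ (-1)]/(qR^-1) mulVf ?qR_neq0// mulr1.
Qed.

Lemma dens_le u (k k' : 'I_n -> int) i : (forall a, k a <= k' a) ->
  ~ lbnd (u i 0) (k' i) -> dens u k' = dens u k.
Proof.
move=> kk'; move: k' kk'.
apply: kbump_ind => // k' j kk' IH ui; rewrite (dens_step ui); apply: IH.
by apply: contra_not ui => h; apply: lbndW h; rewrite /kbump; lia.
Qed.

(** Both boxes are shrunk to common exponents, then enlarged in the coordinates other than i until
    they coincide; coordinate i stays away from 0 throughout. *)
Lemma dens_eq u u' (k k' : 'I_n -> int) i : u i 0 = u' i 0 ->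
  ~ lbnd (u i 0) (k i) -> ~ lbnd (u' i 0) (k' i) -> dens u k = dens u' k'.
Proof.
move=> uu' ui u'i; have [N uN] := col_bnd (u' - u).
pose k0 a := Num.min (k a) (k' a).
pose k1 a := if a == i then k0 a else Num.max (k0 a) N.
have k0k a : k0 a <= k a by rewrite ge_min lexx.
have k0k' a : k0 a <= k' a by rewrite ge_min lexx orbT.
have k01 a : k0 a <= k1 a by rewrite /k1; case: eqP => // _; rewrite le_max lexx.
have uk1 : ~ lbnd (u i 0) (k1 i).
  by rewrite /k1 eqxx; apply: contra_not ui; exact: lbndW.
rewrite (dens_le k0k ui) (dens_le k0k' u'i) -(dens_le k01 uk1).
have u'k1 : ~ lbnd (u' i 0) (k1 i) by rewrite -uu'.
rewrite -(dens_le k01 u'k1); suff e : box u k1 = box u' k1.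
  by rewrite /dens /mass e.
have bu : box u k1 u'.
  move=> a; rewrite /k1; case: eqP => [->|_]; first by rewrite uu' subrr.
  have /cballP/(_ a) := uN; rewrite !mxE; apply: lbndW.
  by rewrite le_max lexx orbT.
by apply/seteqP; split=> v /(box_transl _ bu).
Qed.

(* By [dens_eq] the density near u depends on a single nonzero coordinate of u,
   and as n >= 2 the other coordinates can be changed to 1 first. *)
Lemma mass_const : exists C : R, 0 <= C /\ forall u k, ~ cball k u ->
  mass u (fun=> k) = C * qR ^ (k *+ n).
Proof.
exists (dens (const_mx 1) (fun=> -1)); split=> [|u k uk].
  by rewrite mulr_ge0 ?exprz_ge0// Rintegral_ge0.
have [i ui] : exists i, ~ lbnd (u i 0) k.
  by apply/existsNP; apply: contra_not uk => h; apply/cballP.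
have [j ij] : exists j, j != i.
  pose i0 : 'I_n := Ordinal (ltnW n1); pose i1 : 'I_n := Ordinal n1.
  by have [->|?] := eqVneq i i0; [exists i1 | exists i0; rewrite eq_sym].
pose kk := Num.min k (-1).
pose u1 : 'cV[K]_n := \col_a (if a == i then u i 0 else 1).
have one e : e < 0 -> ~ lbnd (1 : K) e.
  by move=> e0 /(_ 0 e0)/eqP; rewrite lcoef1 eqxx oner_eq0.
suff <- : dens u (fun=> k) = dens (const_mx 1) (fun=> -1).
  rewrite /dens sumr_const card_ord -mulrA -expfzDr ?qR_neq0// addNr.
  by rewrite expr0z mulr1.
transitivity (dens u1 (fun=> kk)).
  apply: (@dens_eq _ _ _ _ i); rewrite ?mxE ?eqxx//.
  by apply: contra_not ui; apply: lbndW; rewrite ge_min lexx.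
apply: (@dens_eq _ _ _ _ j); rewrite ?mxE ?(negPf ij)//; apply: one => //.
by rewrite gt_min orbC.
Qed.

End BoxMass.

(** * Balls around the origin and the constant *)

Section BallMass.
Variables (R : realType) (F : finFieldType) (n : nat).
Local Notation K := (laurent F).
Local Notation G := (SLinf F n).
Local Notation q := (#|F|).
Local Notation qR := (#|F|%:R : R).
Local Notation LS := (borel (lattice_space F n)).
Variable m : probability LS R.
Hypothesis m_inv : lattice_measure_invariant m.
Hypothesis n1 : (1 < n)%N.

Lemma qR_ge1 : 1 <= qR. Proof. by rewrite ler1n ltnW// card_gt1. Qed.

Lemma csers0 lo d : csers lo (0 : 'M[F]_(n, d)) = 0.
Proof.
apply/matrixP => i j; rewrite !mxE; apply: laurentP => e.
by rewrite /=; apply: big1 => a _; rewrite mxE.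
Qed.

Lemma csers_neq0 (k : int) d (c : 'M[F]_(n, d)) : c != 0 ->
  ~ cball k (csers (k + 1) c).
Proof.
move=> c0 /cballP h; move/eqP: c0; apply; apply/matrixP => i a.
by have := h i (k + 1 + a%:Z); rewrite mxE lser_coef mxE => ->//; lia.
Qed.

(** The difference is what an atom at 0 would weigh. It does not depend on k, because the next ball
    around 0 adds q^n - 1 balls that miss 0. *)
Lemma mass_ball_const C : (forall u k, ~ cball k u ->
    mass m u (fun=> k) = C * qR ^ (k *+ n)) ->
  forall k : nat, mass m 0 (fun=> k%:Z) - C * qR ^ (k%:Z *+ n) = mass m 0 (fun=> 0) - C /\
    mass m 0 (fun=> - k%:Z) - C * qR ^ (- k%:Z *+ n) = mass m 0 (fun=> 0) - C.
Proof.
move=> hC.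
pose gap (k : int) := mass m 0 (fun=> k) - C * qR ^ (k *+ n).
have step k : gap (k + 1) = gap k.
  rewrite /gap.
  rewrite (mass_split m_inv n1) (bigD1 0)//= csers0.
  rewrite (eq_bigr (fun=> C * qR ^ (k *+ n))); last first.
    by move=> c c0; apply: hC; exact: csers_neq0.
  rewrite sumr_const -(mulr_natl (C * _)).
  have -> : #|[pred c : 'M[F]_(n, 1) | c != 0]| = (q ^ n - 1)%N.
    have := cardC1 (0 : 'M[F]_(n, 1)); rewrite card_mx muln1 subn1 => <-.
    by apply: eq_card => c; rewrite !inE.
  rewrite natrB ?expn_gt0 ?(ltnW (card_gt1 F))// natrX mulrnDl expfzDr ?qR_neq0//.
  have -> : (1 : int) *+ n = n by rewrite natz.
  by rewrite -exprnP; ring.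
move=> k; rewrite -!/(gap _); have -> : mass m 0 (fun=> 0) - C = gap 0.
  by rewrite /gap mul0rn expr0z mulr1.
clearbody gap; elim: k => [|k [IH1 IH2]]; first by rewrite oppr0.
split; first by rewrite -IH1 -(step k%:Z); congr gap; lia.
by rewrite -IH2 -(step (- k.+1%:Z)); congr gap; lia.
Qed.

Lemma mass_cusp (N : nat) : 2 ^+ N * mass m 0 (fun=> - N%:Z) <= mass m 0 (fun=> 0) + 1.
Proof.
have i1 := integrable_pcount m_inv n1 (0 : 'cV[K]_n) (fun=> - N%:Z).
have i0 := integrable_pcount m_inv n1 (0 : 'cV[K]_n) (fun=> 0).
have ic : m.-integrable setT (EFin \o (fun=> 1 : R)).
  exact: finite_measure_integrable_cst.
rewrite /mass -(RintegralZl (f := fun l : LS =>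
  (pcount (box 0 (fun=> - N%:Z)) l)%:R) _ measurableT i1).
rewrite -[X in _ + X](Rintegral_cst_probability m) -(RintegralD measurableT i0 ic).
apply: (le_Rintegral measurableT (integrableZl measurableT _ i1)
  (integrableD measurableT i0 ic)).
move=> l _ /=; rewrite -natrX -natrM natr1 ler_nat.
by have := pcount_cusp N l; rewrite pcount_lcount.
Qed.

(** The mass and the volume of the ball of radius q^(-N) both decay at least like 2^(-N), so the
    constant gap D between them is 0. *)
Lemma mass_ball : exists C : R, 0 <= C /\
  forall u k, mass m u (fun=> k) = C * qR ^ (k *+ n).
Proof.
have [C [C0 hC]] := mass_const m_inv n1; exists C; split=> //.
have hB := mass_ball_const hC.
set D := mass m 0 (fun=> 0) - C in hB.
have D0 : D = 0.
  have small (N : nat) : 2 ^+ N * `|D| <= mass m 0 (fun=> 0) + 1 + C.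
    have [_ <-] := hB N.
    rewrite -(normr_nat R 2) -normrX -normrM mulrBr (le_trans (ler_normB _ _))//.
    rewrite lerD//.
      by rewrite ger0_norm ?mass_cusp// mulr_ge0// ?exprn_ge0// Rintegral_ge0.
    rewrite ger0_norm; last by rewrite mulr_ge0// ?exprn_ge0// mulr_ge0// exprz_ge0.
    rewrite mulrCA -[leRHS]mulr1 ler_wpM2l//.
    rewrite mulNrn -invr_expz ler_pdivrMr ?mul1r; last first.
      by rewrite exprz_gt0// (lt_le_trans ltr01)// qR_ge1.
    have -> : N%:Z *+ n = (N * n)%N by rewrite -mulr_natr natz PoszM.
    rewrite -exprnP -!natrX ler_nat expnM.
    apply: (@leq_trans (q ^ N)); first by apply: leq_expW; exact: card_gt1.
    by rewrite -{1}[(q ^ N)%N]expn1 leq_pexp2l ?expn_gt0 ?(ltnW (card_gt1 F))// ltnW.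
  apply/eqP; apply: contraT => D0.
  have d0 : 0 < `|D| by rewrite normr_gt0.
  set B := mass m 0 (fun=> 0) + 1 + C in small.
  have B0 : 0 <= B by apply: le_trans (small 0%N); rewrite mul1r.
  have := archi_boundP (divr_ge0 B0 (ltW d0)); set N := Num.bound _ => hN.
  have := small N; rewrite leNgt => /negP; case.
  rewrite ltr_pdivrMr// in hN; apply: lt_le_trans hN _.
  by rewrite ler_pM2r// -natrX ler_nat ltnW// ltn_expl.
move=> u k; have [uk|] := pselect (cball k u); last exact: hC.
have -> : mass m u (fun=> k) = mass m 0 (fun=> k).
  rewrite /mass; suff -> : box u (fun=> k) = box 0 (fun=> k) by [].
  by apply/seteqP; split=> v /(box_transl _ uk).
rewrite D0 in hB; apply/eqP; rewrite -subr_eq0; apply/eqP.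
case: k uk => k _; first by have [] := hB k.
by have [_] := hB k.+1; rewrite NegzE.
Qed.

(* The number of points of a lattice in large balls is exactly the expected one,
   so the constant of proportionality is the density q^n. *)
Lemma mass_ballE u k : mass m u (fun=> k) = qR ^+ n * qR ^ (k *+ n).
Proof.
have [C [C0 hC]] := mass_ball; rewrite hC; congr (_ * _).
have qR0 : 0 < qR by rewrite (lt_le_trans ltr01)// qR_ge1.
have q0 : 0 < qR ^+ n by rewrite exprn_gt0.
pose z : R := (qR ^+ n)^-1.
(* The count in the ball of exponent t, with 0 included, divided by its eventual value q^(n(t + 1)).
   It is at most H by [lcount_lipschitz]. Its integral is C z + z^(t + 1), where the second term is
   due to the zero vector. *)
pose f (t : nat) (l : LS) : R := z ^+ t.+1 * (pcount (cball t%:Z) l).+1%:R.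
have fE t (l : LS) : f t l = z ^+ t.+1 * (lcount (repr l) (cball t%:Z))%:R.
  by rewrite pcount_lcount.
pose H (l : LS) : R := (pcount (cball 0) l).+1%:R.
have f0 t l : 0 <= f t l by rewrite mulr_ge0 ?exprn_ge0// invr_ge0 ltW.
have fH t l : f t l <= H l.
  rewrite fE /H -pcount_lcount /z exprVn ler_pdivrMl ?exprn_gt0//.
  rewrite -exprM -natrX -natrM ler_nat.
  have := lcount_lipschitz (repr l) 0 t; rewrite add0n => /leq_trans; apply.
  by rewrite leq_mul// leq_pexp2l ?(ltnW (card_gt1 F))// leq_mul.
have fcvg (l : LS) : (f t l)%:E @[t --> \oo] --> 1%:E.
  have [k0 hk0] := lcount_large (repr l) (ltnW n1).
  apply: cvg_near_cst; exists k0 => // t /= kt.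
  rewrite fE hk0// natrX exprM /z exprVn mulVf// expf_neq0// gt_eqF//.
have iH : m.-integrable setT (fun l => (H l)%:E) by exact: integrable_H.
have := @dominated_cvg _ _ _ m setT measurableT (fun t l => (f t l)%:E)
  (fun=> 1%:E) (fun l => (H l)%:E).
move=> /(_ _ _ _ _ _)/wrap[].
- move=> t; apply/measurable_EFinP.
  exact: (measurable_pcount 0 (fun=> t%:Z) (fun p => z ^+ t.+1 * p.+1%:R : R)).
- by move=> l _; exact: fcvg.
- by [].
- exact: iH.
- by move=> t l _; rewrite lee_fin ger0_norm.
have If t : (\int[m]_l (f t l)%:E)%E = (C * z + z ^+ t.+1)%:E.
  have ip := integrable_pcount m_inv n1 (0 : 'cV[K]_n) (fun=> t%:Z).
  have ic : m.-integrable setT (EFin \o (fun=> 1 : R)).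
    exact: finite_measure_integrable_cst.
  have ipc := integrableD measurableT ip ic.
  rewrite -[LHS]fineK; last first.
    apply: integrable_fin_num => //.
    apply: eq_integrable (integrableZl measurableT (z ^+ t.+1) ipc) => // l _.
    by rewrite /f -EFinD natr1 EFinM.
  congr EFin; rewrite -/(Rintegral _ _ _).
  under eq_Rintegral do rewrite /f -natr1.
  rewrite (RintegralZl (f := fun l : LS => (pcount (cball t%:Z) l)%:R + 1) _ measurableT ipc).
  rewrite (RintegralD measurableT ip ic) Rintegral_cst_probability.
  rewrite -[Rintegral _ _ _]/(mass m 0 (fun=> t%:Z)) hC mulrDr mulr1; congr (_ + _).
  rewrite mulrCA exprS -[RHS]mulr1 -!mulrA; congr (_ * (_ * _)).
  have -> : t%:Z *+ n = (n * t)%N by rewrite -mulr_natl natz PoszM.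
  by rewrite -exprnP exprM /z exprVn mulVf// expf_neq0// gt_eqF.
under eq_fun do rewrite If.
rewrite -[X in _ --> X]/(\int[m]_l 1%:E)%E.
have -> : (\int[m]_l 1%:E)%E = 1%:E by rewrite integral_cst//= mul1e; exact: probability_setT.
move=> /fine_cvg cz.
have z1 : `|z| < 1.
  rewrite ger0_norm ?invr_ge0 ?ltW// invf_lt1// -natrX ltr1n.
  by rewrite -[X in (X < _)%N](expn0 q) ltn_exp2l ?card_gt1// ltnW.
have cz' : (C * z + z * z ^+ t) @[t --> \oo] --> C * z + z * 0.
  by apply: cvgD; [exact: cvg_cst | apply: cvgM; [exact: cvg_cst | exact: cvg_expr]].
have e : C * z = 1.
  rewrite -[LHS]addr0 -(mulr0 z); apply: (cvg_unique _ cz' _) => //.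
  rewrite /=; have <- : fine \o (fun t : nat => (C * z + z ^+ t.+1)%:E) =
      (fun t : nat => C * z + z * z ^+ t).
    by apply/funext => t; rewrite /= exprS.
  exact: cz.
apply: (mulIf (invr_neq0 (lt0r_neq0 q0))).
by rewrite mulfV ?lt0r_neq0//; exact: e.
Qed.

End BallMass.

(** * Step functions *)

Section HaarBalls.
Variables (R : realType) (F : finFieldType) (n : nat).
Local Notation K := (laurent F).
Local Notation q := (#|F|).
Local Notation qR := (#|F|%:R : R).
Variable Vol : {measure set (borel 'cV[K]_n) -> \bar R}.
Hypothesis Vol_haar : normalized_haar Vol.
Implicit Types (u v : 'cV[K]_n).

Lemma open_box u (k : int) : open (box u (fun=> k)).
Proof.
apply/open_mxP => x /box_cball xk; exists k => y yx; apply/box_cball.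
rewrite -(subrKA x); apply: cballD => //.
by apply/cballP => i; exact: yx.
Qed.

Lemma measurable_box u (k : int) :
  measurable (box u (fun=> k) : set (borel 'cV[K]_n)).
Proof. by apply: (@measurable_open 'cV[K]_n); exact: open_box. Qed.

Lemma Vol_box u (k : int) : Vol (box u (fun=> k)) = Vol (cball k).
Proof.
have [tr _ _] := Vol_haar; rewrite -(tr u _ (measurable_box 0 k)); congr (Vol _).
apply/seteqP; split=> [v /box_cball vk|_ [v vk <-]].
  by exists (v - u) => //; rewrite addrC subrK.
by apply/box_cball; rewrite addrC addKr.
Qed.

Lemma Vol_succ (k : int) : Vol (cball (k + 1)) = ((qR ^+ n)%:E * Vol (cball k))%E.
Proof.
have -> : cball (k + 1) = \bigcup_(c in [set: 'M[F]_(n, 1)]) box (csers (k + 1) c) (fun=> k).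
  apply/seteqP; split=> [v vk|v [c _ /box_csers[]]//].
  by exists (\matrix_(i, m) v i 0 (k + 1 + m%:Z)) => //; apply/box_csers.
rewrite measure_fin_bigcup//; last 3 first.
- exact: finite_finset.
- move=> c c' _ _ [v [/box_csers[_ ->] /box_csers[_ ->]]] //.
- by move=> c _; exact: measurable_box.
rewrite (eq_fsbigr (fun=> Vol (cball k))); last by move=> c _; exact: Vol_box.
rewrite (fsbigE (index_enum 'M[F]_(n, 1)))//; last 2 first.
- exact: index_enum_uniq.
- by move=> c _; rewrite mem_index_enum.
under eq_bigl do rewrite in_setT.
rewrite big_const -natrX (_ : #|_| = (q ^ n)%N); last first.
  by rewrite -[in RHS](muln1 n) -card_mx; apply: eq_card.
elim: (q ^ n)%N => [|e IH]; first by rewrite mul0e.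
rewrite iterS IH -nat1r EFinD ge0_muleDl// mul1e.
by [].
Qed.

(** Descent from Vol(O^n) = 1 by [Vol_succ], an equation that also excludes infinite values. *)
Lemma Vol_ball (N : nat) : Vol (cball (- N%:Z)) = ((qR ^+ n) ^- N)%:E.
Proof.
have q0 : qR ^+ n != 0 by rewrite expf_neq0// qR_neq0.
elim: N => [|N IH].
  rewrite oppr0 expr0 invr1; have [_ _ <-] := Vol_haar; congr (Vol _).
  by apply/seteqP; split=> v => [/cballP|] vO; [|apply/cballP]; exact: vO.
have := Vol_succ (- N.+1%:Z); rewrite (_ : - N.+1%:Z + 1 = - N%:Z); last by lia.
rewrite IH; case: (Vol _) => [x||]; last 2 first.
- by rewrite gt0_muley ?lte_fin ?lt_def ?q0 ?exprn_ge0.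
- by rewrite gt0_muleNy ?lte_fin ?lt_def ?q0 ?exprn_ge0.
rewrite -EFinM => -[] e; congr EFin; apply: (mulfI q0); rewrite -e.
by rewrite exprSr invfM mulrCA mulfV// mulr1.
Qed.

Lemma integrable_box u (N : nat) :
  Vol.-integrable setT (fun v => (\1_(box u (fun=> - N%:Z)) v)%:E).
Proof.
have mB := measurable_box u (- N%:Z); apply/integrableP; split.
  by apply/measurable_EFinP; exact: measurable_indic.
under eq_integral do rewrite gee0_abs ?lee_fin//.
by rewrite integral_indic// setIT Vol_box Vol_ball ltry.
Qed.

Lemma Rintegral_box u (N : nat) :
  \int[Vol]_v \1_(box u (fun=> - N%:Z)) v = (qR ^+ n) ^- N.
Proof.
have mB := measurable_box u (- N%:Z).
by rewrite /Rintegral integral_indic// setIT Vol_box Vol_ball.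
Qed.

End HaarBalls.

(** * Decomposition into indicators of small balls *)

Section Decomposition.
Variables (R : realType) (F : finFieldType) (n : nat).
Local Notation K := (laurent F).
Implicit Types (u v : 'cV[K]_n).

Lemma smooth_radius (f : 'cV[K]_n -> R[i]) : smooth f ->
  exists N : nat, forall u v, cball (- N%:Z) (u - v) -> f u = f v.
Proof.
move=> [e e0 fe]; have [k kb] := ball_lbnd F e0.
exists `|k|%N => u v uv; apply: (fe v); last exact: ballxx.
split=> // i j; apply: kb; rewrite ord1.
have /cballP/(_ i) := uv; rewrite !mxE; apply: lbndW.
by lia.
Qed.

(** The balls around 0 with exponents M in nat form an increasing open cover. *)
Lemma compact_support_radius (f : 'cV[K]_n -> R[i]) : compact_support f ->
  exists M : nat, forall v, ~ cball M%:Z v -> f v = 0.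
Proof.
rewrite /compact_support compact_cover => cf.
have [] := cf nat setT (fun M : nat => cball M%:Z).
- by move=> M _; exact: open_box.
- move=> v _; have [k vk] := col_bnd v; exists `|k|%N => //.
  by apply: cballW vk; lia.
move=> D _ fD; exists (\max_(i <- D) i)%N => v vM; apply/eqP; apply: contraT => fv.
exfalso; apply: vM; have [M /= MD] := fD v (@subset_closure _ _ v fv).
by apply: cballW; rewrite lez_nat; exact: leq_bigmax_seq.
Qed.

Variables (f : 'cV[K]_n -> R[i]) (k : int) (d : nat).
Hypothesis fk : forall u v, cball k (u - v) -> f u = f v.
Hypothesis fd : forall v, ~ cball (k + d%:Z) v -> f v = 0.

Lemma step_function v : f v =
  \sum_(c : 'M[F]_(n, d)) f (csers (k + 1) c) *
    (v \in box (csers (k + 1) c) (fun=> k))%:R.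
Proof.
have [vd|vd] := pselect (cball (k + d%:Z) v); last first.
  rewrite fd// big1// => c _; rewrite memNset ?mulr0// => /box_csers[].
  by move/vd.
pose c0 := \matrix_(i < n, m < d) v i 0 (k + 1 + m%:Z).
have vc0 : box (csers (k + 1) c0) (fun=> k) v by apply/box_csers.
rewrite (bigD1 c0)//= mem_set// mulr1 big1 ?addr0 => [|c cc0].
  exact: (fk ((box_cball _ _ _).1 vc0)).
rewrite memNset ?mulr0// => /box_csers[_ cE].
by move/eqP: cc0; apply.
Qed.

Lemma siegel_sum (l : lattice_space F n) : siegel f l =
  \sum_(c : 'M[F]_(n, d)) f (csers (k + 1) c) *
    (pcount (box (csers (k + 1) c) (fun=> k)) l)%:R.
Proof.
pose X := (lattice l `&` cball (k + d%:Z)) `\ 0.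
have fX : finite_set X by exact/finite_setD/lattice_finite_box.
rewrite /siegel -(fsbig_widen X); last 2 first.
- by move=> v [[lv _] v0].
- move=> v [[lv v0] Xv] /=; apply: fd => vd; apply: Xv; split=> //.
rewrite fsbig_finite// big_seq_cond.
rewrite (partition_big (fun v : 'cV[K]_n =>
  \matrix_(i < n, m < d) v i 0 (k + 1 + m%:Z)) xpredT)//=.
apply: eq_bigr => c _.
have XE v : X v ->
    \matrix_(i, m) v i 0 (k + 1 + m%:Z) = c <-> box (csers (k + 1) c) (fun=> k) v.
  move=> [[lv vd] v0]; split=> [<-|/box_csers[]//]; exact/box_csers.
rewrite (eq_bigr (fun=> f (csers (k + 1) c) * 1)); last first.
  move=> v; rewrite andbT in_fset_set// => /andP[/set_mem Xv /eqP/(XE v Xv)].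
  by move=> /box_cball/fk; rewrite mulr1.
rewrite -big_distrr/=; congr (_ * _).
under eq_bigl do rewrite andbT.
rewrite -big_seq_cond -[LHS]/(\sum_(v <- fset_set X | _) 1%:R) -natr_sum -ncard_cond//.
congr (_%:R); congr ncard; apply/seteqP; split=> v.
  by move=> [Xv /eqP/(XE v Xv) vc]; have [[lv _] v0] := Xv.
move=> [[lv vc] v0]; have /box_csers[vd _] := vc.
have Xv : X v by [].
by split=> //=; apply/eqP/(XE v Xv).
Qed.

End Decomposition.

(** The weights are natural numbers, so additivity of P is enough. Taking P to be the real or the
    imaginary part reduces the theorem to real integrals. *)
Lemma additive_sum_nat (R : realType) (P : R[i] -> R) :
  P 0 = 0 -> {morph P : x y / x + y} ->
  forall (I : finType) (a : I -> R[i]) (c : I -> nat),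
  P (\sum_i a i * (c i)%:R) = \sum_i P (a i) * (c i)%:R.
Proof.
move=> P0 PD I a c; rewrite (big_morph P PD P0); apply: eq_bigr => i _.
rewrite !mulr_natr; elim: (c i) => [|e IH]; first by rewrite !mulr0n.
by rewrite !mulrS PD IH.
Qed.

Lemma siegel_part (R : realType) (F : finFieldType) (n : nat)
    (Vol : {measure set (borel 'cV[laurent F]_n) -> \bar R})
    (m : probability (borel (lattice_space F n)) R)
    (f : 'cV[laurent F]_n -> R[i]) (P : R[i] -> R) :
  (2 <= n)%N -> normalized_haar Vol -> lattice_measure_invariant m ->
  smooth f -> compact_support f ->
  P 0 = 0 -> {morph P : x y / x + y} ->
  m.-integrable setT (fun l => (P (siegel f l))%:E) /\
  \int[m]_l P (siegel f l) = (#|F| ^ n)%:R * \int[Vol]_v P (f v).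
Proof.
move=> n2 hV hm /smooth_radius[N fN] /compact_support_radius[M fM] P0 PD.
have fMN v : ~ cball (- N%:Z + (N + M)%N%:Z) v -> f v = 0.
  by move=> h; apply: fM; rewrite (_ : M%:Z = - N%:Z + (N + M)%N%:Z)//; lia.
(* The function f depends only on the N + M coefficients at the exponents 1 - N, ..., M of each
   coordinate, as long as v stays in the ball of radius q^M. *)
set k := - N%:Z in fN fMN; set d := (N + M)%N in fMN.
pose u c : 'cV[laurent F]_n := @csers F n (k + 1) d c.
have PS l : P (siegel f l) = \sum_c P (f (u c)) * (pcount (box (u c) (fun=> k)) l)%:R.
  by rewrite (siegel_sum fN fMN) additive_sum_nat.
have Pf v : P (f v) = \sum_c P (f (u c)) * \1_(box (u c) (fun=> k)) v.
  by rewrite (step_function fN fMN) additive_sum_nat.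
split.
  have -> : (fun l : borel (lattice_space F n) => (P (siegel f l))%:E) =
      EFin \o (fun l => \sum_c P (f (u c)) * (pcount (box (u c) (fun=> k)) l)%:R).
    by apply/funext => l /=; rewrite PS.
  apply: (@integrable_RsumZ _ _ _ m _ (fun c => P (f (u c)))
    (fun c (l : borel (lattice_space F n)) => (pcount (box (u c) (fun=> k)) l)%:R)) => c.
  exact: integrable_pcount.
under eq_Rintegral do rewrite PS.
under [in RHS]eq_Rintegral do rewrite Pf.
rewrite (@Rintegral_sumZ _ _ _ m _ (fun c => P (f (u c)))
  (fun c (l : borel (lattice_space F n)) => (pcount (box (u c) (fun=> k)) l)%:R)); last first.
  by move=> c; exact: integrable_pcount.
rewrite (@Rintegral_sumZ _ _ _ Vol _ (fun c => P (f (u c)))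
  (fun c (v : borel 'cV[laurent F]_n) => \1_(box (u c) (fun=> k)) v)); last first.
  by move=> c; exact: integrable_box.
rewrite big_distrr/=; apply: eq_bigr => c _; rewrite mulrCA; congr (_ * _).
rewrite Rintegral_box// -/(mass m _ _) mass_ballE// natrX; congr (_ * _).
rewrite /k mulNrn -invr_expz -exprM; congr (_^-1).
by rewrite [RHS]exprnP; congr (_ ^ _); rewrite -mulr_natl natz PoszM.
Qed.

Theorem theorem1p5 (R : realType) (F : finFieldType) (n : nat)
    (Vol : {measure set (borel 'cV[laurent F]_n) -> \bar R})
    (m : probability (borel (lattice_space F n)) R)
    (f : 'cV[laurent F]_n -> R[i]) :
  (2 <= n)%N ->
  normalized_haar Vol ->
  lattice_measure_invariant m ->
  smooth f ->
  compact_support f ->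
  cintegrable m (siegel f) /\
  cintegral m (siegel f) = (#|F| ^ n)%:R * cintegral Vol f.
Proof.
move=> n2 hV hm sf cf.
have ReD : {morph @complex.Re R : x y / x + y} by move=> [a b] [c d].
have ImD : {morph @complex.Im R : x y / x + y} by move=> [a b] [c d].
have [iRe eRe] := siegel_part n2 hV hm sf cf (P := @complex.Re R) erefl ReD.
have [iIm eIm] := siegel_part n2 hV hm sf cf (P := @complex.Im R) erefl ImD.
split; first by split.
rewrite /cintegral eRe eIm; move: (Rintegral _ _ _) (Rintegral _ _ _) => a b.
have -> : (#|F| ^ n)%:R = Complex ((#|F| ^ n)%:R : R) 0.
  elim: (#|F| ^ n)%N => // e IH; rewrite -!natr1 IH.
  by apply/eqP; rewrite eq_complex /= addr0 !eqxx.
by apply/eqP; rewrite eq_complex /= !mul0r subr0 addr0 !eqxx.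
Qed.
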